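(* Let $\cong$ be a congruence on LTSs such that $L\doteq L'$ implies $L\cong L'$ and $V\cong B$. Then: (1) if $\cong$ preserves $\mathit{nF}$ but preserves neither $\mathit{Sf}$ nor $\mathit{aenI}$, then $\cong$ is the equivalence induced by $\Sigma,\mathit{nF},\mathit{Div},\mathit{eanI}$; (2) if $\cong$ preserves $\mathit{nF}$ and $\mathit{aenI}$ but preserves neither $\mathit{Sf}$ nor $\mathit{Inf}$, then $\cong$ is the equivalence induced by $\Sigma,\mathit{nF},\mathit{Div},\mathit{aenI}$; (3) if $\cong$ preserves $\mathit{nF}$ and $\mathit{Inf}$ but does not preserve $\mathit{Sf}$, then $\cong$ is the equivalence induced by $\Sigma,\mathit{nF},\mathit{Div},\mathit{Inf}$.
   Context: An LTS is a tuple $L=(S,\Sigma,\Delta,\hat s)$ with states $S$, alphabet $\Sigma$ (possibly infinite), $\tau\notin\Sigma$ a reserved invisible action, transitions $\Delta\subseteq S\times(\Sigma\cup\{\tau\})\times S$, initial state $\hat s$; $\Sigma(L)$ denotes the alphabet. Operators: action prefix $a.L$ ($a\neq\tau$): new initial state $\hat s'$, alphabet $\Sigma\cup\{a\}$, transitions $\Delta\cup\{(\hat s',a,\hat s)\}$. Hiding $L\setminus A$: alphabet $\Sigma\setminus A$, each transition labelled by an element of $A$ relabelled $\tau$, otherwise unchanged. Relational renaming $L\Phi$ ($\Phi$ a set of pairs, $\tau$ not in its domain $\mathcal D(\Phi)$ or range; $\Phi(a,b)$ means $(a,b)\in\Phi$ or $a=b\notin\mathcal D(\Phi)$): alphabet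 $\{b\mid\exists a\in\Sigma:\Phi(a,b)\}$, transitions $\{(s,b,s')\mid\exists a:(s,a,s')\in\Delta\wedge\Phi(a,b)\}$, same states and initial state. Parallel composition $L_1\|L_2$: states $S_1\times S_2$, alphabet $\Sigma_1\cup\Sigma_2$, initial $(\hat s_1,\hat s_2)$; actions in $\Sigma_1\cap\Sigma_2$ are taken jointly by both components, all other actions (including $\tau$) by one component while the other stays put. A congruence is an equivalence $\cong$ with $L\cong L'\Rightarrow a.L\cong a.L',\ L\setminus A\cong L'\setminus A,\ L\Phi\cong L'\Phi,\ L\|L''\cong L'\|L'',\ L''\|L\cong L''\|L'$. For $\sigma=a_1\cdots a_n\in\Sigma^*$, $s\stackrel{\sigma}{\Rightarrow}s'$ means a finite path from $s$ to $s'$ whose non-$\tau$ labels are exactly $a_1,\dots,a_n$ in order; $\hat s\stackrel{\xi}{\Rightarrow}$ for $\xi\in\Sigma^\omega$ means an infinite path from $\hat s$ whose non-$\tau$ label sequence is $\xi$; $s\stackrel{\tau^\omega}{\to}$ means an infinite path of $\tau$-transitions from $s$. Define $\mathit{Tr}(L)=\{\sigma\in\Sigma^*\mid\exists s:\hat s\stackrel\sigma\Rightarrow s\}$, $\mathit{Div}(L)=\{\sigma\in\Sigma^*\mid\exists s:\hat s\stackrel\sigma\Rightarrow s\wedge s\stackrel{\tau^\omega}\to\}$, $\mathit{Inf}(L)=\{\xi\in\Sigma^\omega\mid\hat s\stackrel\xi\Rightarrow\}$, $\mathit{Sf}(L)=\{(\sigma,A)\in\Sigma^*\times2^\Sigma\mid\exists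 s:\hat s\stackrel\sigma\Rightarrow s\wedge\forall a\in A\cup\{\tau\}\,\forall s':(s,a,s')\notin\Delta\}$. Further: $\mathit{eanI}(L)=\{a_1a_2\cdots\in\mathit{Inf}(L)\mid\exists n\ge0\,\forall i\ge n: a_1\cdots a_i\notin\mathit{Div}(L)\}$; $\mathit{aenI}(L)=\{a_1a_2\cdots\in\mathit{Inf}(L)\mid\forall n\ge0\,\exists i\ge n: a_1\cdots a_i\notin\mathit{Div}(L)\}$; $\mathit{nF}(L)=\{(\sigma,A)\in\mathit{Sf}(L)\mid\sigma\notin\mathit{Div}(L)\}$. $L\doteq L'$ (CFFD-equivalence) iff $\Sigma,\mathit{Sf},\mathit{Div},\mathit{Inf}$ all agree on $L$ and $L'$. An equivalence preserves $X$ if $L\cong L'\Rightarrow X(L)=X(L')$; the equivalence induced by $\Sigma,X_1,\dots,X_k$ relates $L,L'$ iff all these functions agree on them. $V$ is the one-state LTS with empty alphabet and a single $\tau$ self-loop; $B$ is the LTS with empty alphabet, states $s_0$ (initial) and $s_1$, and transitions $(s_0,\tau,s_0)$, $(s_0,\tau,s_1)$. *)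

(* Defs.v *)
From mathcomp Require Import all_boot.
From mathcomp Require Import boolp classical_sets cardinality.
From Stdlib Require Import RelationClasses.

Set Implicit Arguments.
Unset Strict Implicit.
Unset Printing Implicit Defensive.

Local Open Scope classical_set_scope.

(* Visible actions are drawn from a type Act.  A transition label is an
   [option Act], where [None] is the invisible action tau, so that tau is never
   a member of an alphabet. *)
Record lts (Act : Type) := LTS {
  st : Type;
  alph : set Act;
  trans : st -> option Act -> st -> Prop;
  init : st;
  trans_alph : forall s a s', trans s (Some a) s' -> alph a
}.

Section Operators.
Variable Act : Type.
Implicit Types (L : lts Act) (A : set Act) (a b : Act) (l : option Act).

(* In [prefix_trans] and [prefix], the state [None] is the new initial state. *)
Definition prefix_trans a L (x : option (st L)) l (y : option (st L)) : Prop :=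
  match x, y with
  | Some s, Some s' => trans s l s'
  | None, Some s' => l = Some a /\ s' = init L
  | _, None => False
  end.

Lemma prefix_trans_alph a L x b y :
  @prefix_trans a L x (Some b) y -> (alph L `|` [set a]) b.
Proof.
case: x y => [s|] [s'|] //=; first by move=> H; left; exact: trans_alph H.
by move=> [[->] _]; right.
Qed.

Definition prefix a L : lts Act :=
  LTS None (@prefix_trans_alph a L).

Definition hide_trans L A (s : st L) l (s' : st L) : Prop :=
  match l with
  | None => trans s None s' \/ exists2 a, A a & trans s (Some a) s'
  | Some b => trans s (Some b) s' /\ ~ A b
  end.

Lemma hide_trans_alph L A s b s' :
  @hide_trans L A s (Some b) s' -> (alph L `\` A) b.
Proof. by move=> [H nA]; split => //; exact: trans_alph H. Qed.

Definition hide L A : lts Act :=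
  LTS (init L) (@hide_trans_alph L A).

(* The reading of Phi(a, b): pairs in Phi, extended by the identity outside the
   domain of Phi.  As Phi only relates visible actions, tau is left alone. *)
Definition ren (Phi : set (Act * Act)) a b : Prop :=
  Phi (a, b) \/ (a = b /\ ~ exists c, Phi (a, c)).

Definition rename_trans L Phi (s : st L) l (s' : st L) : Prop :=
  match l with
  | None => trans s None s'
  | Some b => exists2 a, trans s (Some a) s' & ren Phi a b
  end.

Lemma rename_trans_alph L Phi s b s' :
  @rename_trans L Phi s (Some b) s' ->
  [set c | exists2 a, alph L a & ren Phi a c] b.
Proof. by move=> [a H ab]; exists a => //; exact: trans_alph H. Qed.

Definition rename L (Phi : set (Act * Act)) : lts Act :=
  LTS (init L) (@rename_trans_alph L Phi).

Definition in_alph L l : Prop := if l is Some a then alph L a else False.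

Definition par_trans L1 L2 (x : st L1 * st L2) l (y : st L1 * st L2) : Prop :=
  [\/ [/\ in_alph L1 l, in_alph L2 l, trans x.1 l y.1 & trans x.2 l y.2],
      [/\ ~ in_alph L2 l, trans x.1 l y.1 & y.2 = x.2] |
      [/\ ~ in_alph L1 l, trans x.2 l y.2 & y.1 = x.1]].

Lemma par_trans_alph L1 L2 x b y :
  @par_trans L1 L2 x (Some b) y -> (alph L1 `|` alph L2) b.
Proof.
case=> [[? _ _ _]|[_ H _]|[_ H _]]; first by left.
- by left; exact: trans_alph H.
- by right; exact: trans_alph H.
Qed.

Definition par L1 L2 : lts Act :=
  LTS (init L1, init L2) (@par_trans_alph L1 L2).

End Operators.

Record congruence (Act : Type) (R : lts Act -> lts Act -> Prop) : Prop := {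
  cong_equiv : Equivalence R;
  cong_prefix : forall a L L', R L L' -> R (prefix a L) (prefix a L');
  cong_hide : forall A L L', R L L' -> R (hide L A) (hide L' A);
  cong_rename : forall Phi L L', R L L' -> R (rename L Phi) (rename L' Phi);
  cong_parl : forall M L L', R L L' -> R (par L M) (par L' M);
  cong_parr : forall M L L', R L L' -> R (par M L) (par M L')
}.

Section Semantics.
Variables (Act : Type) (L : lts Act).
Implicit Types (s : st L) (sigma : seq Act) (xi : nat -> Act) (A : set Act).

Fixpoint path_of s (ls : seq (option Act)) s' : Prop :=
  if ls is l :: ls' then exists2 t, trans s l t & path_of t ls' s' else s = s'.

Definition weak s sigma s' : Prop :=
  exists2 ls, path_of s ls s' & pmap id ls = sigma.

Definition inf_path s (p : nat -> st L) (ls : nat -> option Act) : Prop :=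
  p 0 = s /\ forall n, trans (p n) (ls n) (p n.+1).

(* xi is the sequence of the visible elements of ls: f i is the position of the
   i-th visible element, and every visible element is at such a position. *)
Definition visible_seq (ls : nat -> option Act) xi : Prop :=
  exists f : nat -> nat,
    [/\ forall i j, i < j -> f i < f j,
        forall i, ls (f i) = Some (xi i) &
        forall n, ls n <> None -> exists i, n = f i].

Definition weak_inf s xi : Prop :=
  exists p ls, inf_path s p ls /\ visible_seq ls xi.

Definition diverges s : Prop := exists p, inf_path s p (fun=> None).

(* Elements of the sets below only involve actions of the alphabet of L, thanks
   to [trans_alph]; only the refusal sets need an explicit restriction. *)
Definition Div : set (seq Act) :=
  [set sigma | exists2 s, weak (init L) sigma s & diverges s].

Definition Inf : set (nat -> Act) := [set xi | weak_inf (init L) xi].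

Definition Sf : set (seq Act * set Act) :=
  [set sA | sA.2 `<=` alph L /\
    exists s, [/\ weak (init L) sA.1 s,
                  forall s', ~ trans s None s' &
                  forall a, sA.2 a -> forall s', ~ trans s (Some a) s']].

(* [mkseq xi i] is the prefix of length i of xi. *)
Definition eanI : set (nat -> Act) :=
  [set xi | Inf xi /\ exists n, forall i, n <= i -> ~ Div (mkseq xi i)].

Definition aenI : set (nat -> Act) :=
  [set xi | Inf xi /\ forall n, exists2 i, n <= i & ~ Div (mkseq xi i)].

Definition nF : set (seq Act * set Act) :=
  [set sA | Sf sA /\ ~ Div sA.1].

End Semantics.

Definition preserves (Act : Type) (R : lts Act -> lts Act -> Prop) (T : Type)
    (X : lts Act -> T) : Prop :=
  forall L L', R L L' -> X L = X L'.

Definition induced (Act T1 T2 T3 T4 : Type) (X1 : lts Act -> T1)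
    (X2 : lts Act -> T2) (X3 : lts Act -> T3) (X4 : lts Act -> T4)
    (L L' : lts Act) : Prop :=
  [/\ X1 L = X1 L', X2 L = X2 L', X3 L = X3 L' & X4 L = X4 L'].

Definition CFFD_eq (Act : Type) : lts Act -> lts Act -> Prop :=
  induced (@alph Act) (@Sf Act) (@Div Act) (@Inf Act).

Section VB.
Variable Act : Type.

Definition V_trans (s : unit) (l : option Act) (s' : unit) : Prop := l = None.

Lemma V_trans_alph s a s' : V_trans s (Some a) s' -> set0 a.
Proof. by []. Qed.

Definition V : lts Act := LTS tt V_trans_alph.

(* s_0 is [false] and s_1 is [true]. *)
Definition B_trans (s : bool) (l : option Act) (s' : bool) : Prop :=
  s = false /\ l = None.

Lemma B_trans_alph s a s' : B_trans s (Some a) s' -> set0 a.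
Proof. by case. Qed.

Definition B : lts Act := LTS false B_trans_alph.

End VB.

(* Main.v *)
Require Import Defs.
From mathcomp Require Import all_boot zify.
From mathcomp Require Import boolp classical_sets functions cardinality.
From Stdlib Require Import RelationClasses.

(* Every LTS L is CFFD-equivalent to a context around V: next to L, a driver may
   abandon L in any divergent state and park in a state whose only partner is V.
   Replacing V by B turns each divergence trace into a stable failure with every
   refusal set, so the congruence cannot see stable failures at divergence
   traces; with preservation of nF this settles (3).

   In (1) and (2) two congruent systems are separated by an infinite trace xi.
   A tester running along xi turns this into a pair of congruent systems over a
   single action c, only one of which can do c forever.  Driven by it, the driver
   may leave L at a divergence trace and jump along chosen words from one
   divergence trace to the next, paying c's for each jump: infinitely many jumps
   are possible with one system and impossible with the other.  This adds to
   Inf(L) the infinite words with infinitely many divergent prefixes in (1), and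
   those with almost all prefixes divergent in (2), and changes nothing else, so
   only eanI, respectively aenI, remains visible.

   Conversely, a tester following a word turns a divergence trace into a
   nondivergent stable failure or its absence, so a congruence preserving nF
   preserves the alphabet, Div and eanI.  The fresh actions come from an
   injection of the infinite type Act into itself missing two points. *)

Set Implicit Arguments.
Unset Strict Implicit.
Unset Printing Implicit Defensive.

Local Open Scope classical_set_scope.

(** * Paths and infinite traces *)

Section Descent.
Variables (T : Type) (r : T -> T -> Prop).

(** Divergence and infinite traces are both handled as failures of accessibility, so that their
    absence becomes an induction principle. *)
Lemma not_Acc_chain x :
  ~ Acc r x -> exists p : nat -> T, p 0 = x /\ forall n, r (p n.+1) (p n).
Proof.
move=> nx.
have step (y : {y | ~ Acc r y}) : {z : {y | ~ Acc r y} | r (sval z) (sval y)}.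
  apply: cid; case: y => y ny /=; apply: contrapT => H; apply: ny.
  constructor=> z zy; apply: contrapT => nz; apply: H.
  by exists (exist _ z nz).
exists (fun n => sval (iter n (fun y => sval (step y)) (exist _ x nx))).
by split=> // n /=; case: (step _).
Qed.

Lemma chain_not_Acc (p : nat -> T) :
  (forall n, r (p n.+1) (p n)) -> ~ Acc r (p 0).
Proof.
move=> pr ap; suff: forall x, Acc r x -> forall n, x <> p n by move/(_ _ ap 0).
by move=> x; elim=> {}x _ IH n xE; apply: (IH _ _ n.+1 erefl); rewrite xE.
Qed.

End Descent.

Section Paths.
Variables (Act : Type) (L : lts Act).
Implicit Types (s t u : st L) (w : seq Act) (xi : nat -> Act) (a : Act).

Lemma path_of_cat s ls1 ls2 t :
  path_of s (ls1 ++ ls2) t <-> exists2 u, path_of s ls1 u & path_of u ls2 t.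
Proof.
elim: ls1 s => [|l ls1 IH] s /=.
  by split=> [H|[u <-]] //; exists s.
split=> [[v sv /IH[u vu ut]]|[u [v sv vu] ut]].
  by exists u => //; exists v.
by exists v => //; apply/IH; exists u.
Qed.

Lemma weak_refl s : weak s [::] s. Proof. by exists [::]. Qed.

Lemma weak_cat w1 w2 s u t :
  weak s w1 u -> weak u w2 t -> weak s (w1 ++ w2) t.
Proof.
move=> [ls1 p1 <-] [ls2 p2 <-]; exists (ls1 ++ ls2); last exact: pmap_cat.
by apply/path_of_cat; exists u.
Qed.

Lemma weak_tau s t : trans s None t -> weak s [::] t.
Proof. by move=> H; exists [:: None] => //; exists t. Qed.

Lemma weak_act a s t : trans s (Some a) t -> weak s [:: a] t.
Proof. by move=> H; exists [:: Some a] => //; exists t. Qed.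

Lemma weak_taul w s u t : trans s None u -> weak u w t -> weak s w t.
Proof. by move=> /weak_tau; apply: weak_cat. Qed.

Lemma weak_taur w s u t : weak s w u -> trans u None t -> weak s w t.
Proof. by move=> H /weak_tau; rewrite -[w]cats0; apply: weak_cat. Qed.

Lemma weak_actl a w s u t :
  trans s (Some a) u -> weak u w t -> weak s (a :: w) t.
Proof. by move=> /weak_act; apply: (@weak_cat [:: a]). Qed.

Lemma weak_actr a w s u t :
  weak s w u -> trans u (Some a) t -> weak s (rcons w a) t.
Proof. by rewrite -cats1 => H /weak_act; apply: weak_cat. Qed.

Lemma weak_consE a w s t : weak s (a :: w) t ->
  exists u v, [/\ weak s [::] u, trans u (Some a) v & weak v w t].
Proof.
case=> ls; elim: ls s => [|[b|] ls IH] s //= [u su].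
  by move=> ut [<- <-]; exists s, u; split=> //; [exact: weak_refl|exists ls].
move=> ut lsE; have [v [v' [uv vv' H]]] := IH _ ut lsE.
by exists v, v'; split=> //; apply: weak_taul uv.
Qed.

Lemma weak_split w1 w2 s t : weak s (w1 ++ w2) t ->
  exists2 u, weak s w1 u & weak u w2 t.
Proof.
elim: w1 s => [|a w1 IH] s; first by exists s => //; exact: weak_refl.
rewrite cat_cons => /weak_consE[u [v [su uv /IH[u' vu' ut]]]].
by exists u' => //; apply: (weak_cat su (weak_actl uv vu')).
Qed.

Lemma weak_alph w1 a w2 s t : weak s (w1 ++ a :: w2) t -> alph L a.
Proof. by case/weak_split=> u _ /weak_consE[? [? [_ H _]]]; apply: trans_alph H. Qed.

(** Invariants are extended at the right end of a trace although [path_of] unfolds from the left;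
    [w0] accumulates the part already read. *)
Lemma weak_invariant (I : seq Act -> st L -> Prop) :
  (forall w s t, I w s -> trans s None t -> I w t) ->
  (forall w s a t, I w s -> trans s (Some a) t -> I (rcons w a) t) ->
  forall w0 s w t, I w0 s -> weak s w t -> I (w0 ++ w) t.
Proof.
move=> Itau Iact w0 s w t Is [ls + <-].
elim: ls w0 s Is => [|[a|] ls IH] w0 s Is /=; first by move=> <-; rewrite cats0.
  by case=> u su ut; rewrite -cat_rcons; apply: IH ut; apply: Iact su.
by case=> u su; apply: IH; apply: Itau su.
Qed.

Definition tau_below t s := trans s None t.

Lemma divergesP s : diverges s <-> ~ Acc tau_below s.
Proof.
split=> [[p [p0 pt]]|nA]; first by rewrite -p0; apply: chain_not_Acc.
by have [p [p0 pt]] := not_Acc_chain nA; exists p.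
Qed.

Lemma nondivergesP s : ~ diverges s <-> Acc tau_below s.
Proof. by rewrite divergesP not_notE. Qed.

Lemma stable_Acc s : (forall t, ~ trans s None t) -> Acc tau_below s.
Proof. by move=> H; constructor=> t /H. Qed.

Lemma Div_diverges w s : weak (init L) w s -> ~ Div L w -> Acc tau_below s.
Proof. by move=> ws nD; apply/nondivergesP => sd; apply: nD; exists s. Qed.

Lemma Div_weak w1 w2 : Div L (w1 ++ w2) ->
  exists s, weak (init L) w1 s.
Proof. by case=> t /weak_split[s]; exists s. Qed.

Definition seg xi i j := [seq xi k | k <- iota i (j - i)].

Lemma seg0 xi j : seg xi 0 j = mkseq xi j.
Proof. by rewrite /seg subn0. Qed.

Lemma segii xi i : seg xi i i = [::].
Proof. by rewrite /seg subnn. Qed.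

Lemma segS xi i : seg xi i i.+1 = [:: xi i].
Proof. by rewrite /seg subSnn. Qed.

Lemma seg_cat xi i j k : i <= j <= k -> seg xi i j ++ seg xi j k = seg xi i k.
Proof.
case/andP=> ij jk; rewrite /seg -map_cat -[in iota j _](subnKC ij) -iotaD.
by congr (map _ (iota _ _)); lia.
Qed.

Lemma seg_cons xi i j : i < j -> seg xi i j = xi i :: seg xi i.+1 j.
Proof. by move=> ij; rewrite -(@seg_cat _ i i.+1) ?leqnSn // segS. Qed.

Lemma mkseq_seg xi i j : i <= j -> mkseq xi i ++ seg xi i j = mkseq xi j.
Proof. by move=> ij; rewrite -!seg0 seg_cat. Qed.

(** The number [v n] of visible labels among the first [n] rises by at most one per step and is
    unbounded, so every [k] is the count just before some visible label; that position is [f k]. *)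
Lemma visible_seqI (ls : nat -> option Act) xi :
  (forall n, exists k, pmap id (mkseq ls n) = mkseq xi k) ->
  (forall k, exists n, k < size (pmap id (mkseq ls n))) ->
  visible_seq ls xi.
Proof.
pose v n := size (pmap id (mkseq ls n)) => pref unb.
have vS n : v n.+1 = v n + (ls n : bool).
  by rewrite /v mkseqS -cats1 pmap_cat size_cat /=; case: (ls n).
have prefE n : pmap id (mkseq ls n) = mkseq xi (v n).
  by rewrite /v; have [k ->] := pref n; rewrite size_mkseq.
have vmono : {homo v : m n / m <= n}.
  by apply: homo_leq => [n|m n k|n]; [|exact: leq_trans|rewrite vS leq_addr].
have [f fP] : {f : nat -> nat & forall k, v (f k) = k /\ ls (f k)}.
  apply: (@choice _ _ (fun k n => v n = k /\ ls n)) => k.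
  have [n] := unb k; rewrite -/(v n); elim: n => // n IH.
  rewrite vS; case lsn: (ls n) => [a|] /=; last by rewrite addn0.
  rewrite addn1 ltnS leq_eqVlt => /predU1P[->|/IH //].
  by exists n; rewrite lsn.
exists f; split=> [i j ij|i|n lsn].
- rewrite ltnNge; apply/negP => /vmono.
  by rewrite (fP i).1 (fP j).1 leqNgt ij.
- have [vi li] := fP i; have := prefE (f i).+1.
  rewrite vS mkseqS -cats1 pmap_cat prefE vi.
  case: (ls _) li => //= a _; rewrite addn1 mkseqS cats1.
  by move/(congr1 (last a)); rewrite !last_rcons => ->.
- have [vf lf] := fP (v n); exists (v n).
  have lt i j : ls i -> v i = v j -> i < j -> False.
    by move=> li vij /vmono; rewrite vS -vij li addn1 ltnn.
  have {}lsn : ls n by case: (ls n) lsn.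
  by case: (ltngtP n (f (v n))) => // H; [case: (lt n _ lsn _ H)|case: (lt _ n lf _ H)].
Qed.

Lemma visible_seqE (ls : nat -> option Act) xi : visible_seq ls xi ->
  exists g : nat -> nat,
    [/\ g 0 = 0, forall k, g k <= g k.+1 &
      forall k, pmap id [seq ls i | i <- iota (g k) (g k.+1 - g k)] = [:: xi k]].
Proof.
case=> f [fmono fxi fonly].
have hidden n m : (forall i, n <= i < n + m -> forall k, i <> f k) ->
    pmap id [seq ls i | i <- iota n m] = [::].
  elim: m n => [|m IH] n H //=; case lsn: (ls n) => [a|] /=.
    case: (fonly n); first by rewrite lsn.
    by move=> k /H []; rewrite leqnn /= addnS ltnS leq_addr.
  by apply: IH => i /andP[ni im]; apply: H; rewrite (ltnW ni) addnS -addSn.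
pose g k := if k is k'.+1 then (f k').+1 else 0.
have gf k : g k <= f k by case: k => //= k; apply: fmono.
exists g; split=> // [k|k]; first by rewrite ltnW // ltnS gf.
rewrite /= subSn // -addn1 iotaD map_cat pmap_cat hidden /=.
  by rewrite subnKC // fxi.
move=> i; rewrite subnKC // => /andP[gi ik] j ij.
have fle x y : f x <= f y -> x <= y.
  by rewrite leqNgt => H; rewrite leqNgt; apply: contra H; apply: fmono.
have {fle} jk : j < k.
  rewrite ltn_neqAle fle; last by rewrite -ij ltnW.
  by rewrite andbT; apply: contraTneq ik => <-; rewrite ij ltnn.
case: k {gf} gi ik jk => //= k; rewrite ij => fk _.
rewrite ltnS leq_eqVlt => /predU1P[jk|/fmono]; last by rewrite ltnNge ltnW.
by move: fk; rewrite jk ltnn.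
Qed.

Lemma path_of_iota (p : nat -> st L) ls : (forall n, trans (p n) (ls n) (p n.+1)) ->
  forall m n, path_of (p n) [seq ls i | i <- iota n m] (p (n + m)).
Proof.
move=> H; elim=> [|m IH] n /=; first by rewrite addn0.
by exists (p n.+1) => //; rewrite -addSnnS.
Qed.

Lemma weak_infP s xi : weak_inf s xi <->
  exists p : nat -> st L, p 0 = s /\ forall n, weak (p n) [:: xi n] (p n.+1).
Proof.
split=> [[p [ls [[p0 pt]]]]|[p [p0 pw]]].
  case/visible_seqE=> g [g0 gS gxi]; exists (fun k => p (g k)); rewrite g0.
  split=> // k; exists [seq ls i | i <- iota (g k) (g k.+1 - g k)] => //.
  by rewrite -[in p (g k.+1)](subnKC (gS k)); apply: path_of_iota.
have [seg_ segP] : {seg_ & forall n, path_of (p n) (seg_ n) (p n.+1) /\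
    pmap id (seg_ n) = [:: xi n]}.
  apply: (@choice _ _ (fun n ls => path_of (p n) ls (p n.+1) /\
    pmap id ls = [:: xi n])) => n.
  by have [ls pls lsE] := pw n; exists ls.
(* A cursor [(n, u, ls)] stands at [u] with the path [ls] to [p n] ahead. *)
pose cur := (nat * st L * seq (option Act))%type.
pose ok (z : cur) := path_of z.1.2 z.2 (p z.1.1).
(* An exhausted cursor loads the path to the next point of [p] and consumes its first label; any
   other cursor consumes one label of the path ahead. *)
have step (z : {z | ok z}) : {lz : option Act * {z | ok z} |
    [/\ trans (sval z).1.2 lz.1 (sval lz.2).1.2,
        (sval z).1.1 <= (sval lz.2).1.1,
        pmap id (lz.1 :: (sval lz.2).2) =
          pmap id (sval z).2 ++ seg xi (sval z).1.1 (sval lz.2).1.1 &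
        (sval z).2 = [::] /\ (sval z).1.1 < (sval lz.2).1.1 \/
          size (sval lz.2).2 < size (sval z).2]}.
  apply: cid; case: z => -[[n u] [|l ls]] zok; have := zok; rewrite {1}/ok /= => zok'.
    have [] := segP n; case: (seg_ n) => [|l ls] //= [t ut tp] lsE.
    exists (l, exist ok (n.+1, t, ls) tp) => /=.
    by rewrite segS zok'; split=> //; left.
  case: zok' => t ut tp; exists (l, exist ok (n, t, ls) tp) => /=.
  by rewrite segii cats0; split=> //; right.
have ok0 : ok (0, s, [::]) by rewrite /ok /= p0.
pose z n := iter n (fun y => (sval (step y)).2) (exist ok _ ok0).
pose ls n := (sval (step (z n))).1.
have zP n := svalP (step (z n)).
exists (fun n => (sval (z n)).1.2), ls; split.
  by split=> // n; have [] := zP n.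
have past n : pmap id (mkseq ls n) ++ pmap id (sval (z n)).2 =
    mkseq xi (sval (z n)).1.1.
  elim: n => [|n IH] //; have [_ le lsE _] := zP n.
  rewrite -(mkseq_seg xi le) -IH -catA -lsE mkseqS -cats1 pmap_cat -catA.
  by congr cat; rewrite /ls /=; case: (sval (step _)).1.
have mono n : (sval (z n)).1.1 <= (sval (z n.+1)).1.1 by have [] := zP n.
(* The path ahead is finite, so the cursor is exhausted sooner or later and then turns to a later
   point of [p]. *)
have grow n : exists m, [/\ (sval (z n)).1.1 <= (sval (z m)).1.1,
    (sval (z m)).2 = [::] & (sval (z m)).1.1 < (sval (z m.+1)).1.1].
  have [k] := ubnP (size (sval (z n)).2); elim: k n => // k IH n; rewrite ltnS => lek.
  have [_ _ _ [[ze lt]|lt]] := zP n; first by exists n.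
  have [m [nm me lt']] := IH n.+1 (leq_trans lt lek).
  by exists m; split=> //; apply: leq_trans nm.
have unb k : exists m, k <= (sval (z m)).1.1.
  elim: k => [|k [m km]]; first by exists 0.
  have [m' [mm' _ lt]] := grow m; exists m'.+1.
  exact: leq_ltn_trans (leq_trans km mm') lt.
apply: visible_seqI => [n|k].
  exists (size (pmap id (mkseq ls n))).
  have := congr1 (take (size (pmap id (mkseq ls n)))) (past n).
  rewrite take_size_cat // => {1}->; rewrite /mkseq -map_take take_iota.
  have/(congr1 size) := past n; rewrite size_cat size_mkseq => <-.
  by rewrite (minn_idPl _) ?leq_addr.
have [n kn] := unb k.+1; have [m [nm me _]] := grow n; exists m.
have/(congr1 size) := past m; rewrite me cats0 size_mkseq => ->.
exact: leq_trans nm.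
Qed.

End Paths.

Lemma weak_lift (Act : Type) (L P : lts Act) (phi : st L -> st P) s t :
  (forall u v, trans u None v -> trans (phi u) None (phi v)) ->
  weak s [::] t -> weak (phi s) [::] (phi t).
Proof.
move=> phi_tau st; pose I (w : seq Act) t := w = [::] -> weak (phi s) [::] (phi t).
suff: I ([::] ++ [::]) t by apply.
apply: (weak_invariant (I := I)) st => [w u v H /phi_tau uv /H|[|? ?]//|_].
  by move=> H'; apply: weak_taur H' uv.
exact: weak_refl.
Qed.

(** Every round contains a genuine tau step, so the path through it starts with a step down in
    [tau_below], even if the silent moves around that step are empty. *)
Lemma diverges_coind (Act : Type) (L : lts Act) (P : st L -> Prop) s :
  (forall u, P u -> exists v v' t,
     [/\ weak u [::] v, trans v None v', weak v' [::] t & P t]) ->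
  P s -> diverges s.
Proof.
move=> Pstep Ps; apply/divergesP => As.
suff: forall t, weak s [::] t -> P t -> False by apply; [exact: weak_refl|exact: Ps].
elim: As => {Ps}s _ IH t sst /Pstep[v [v' [u [tv vv' v'u Pu]]]].
have [y sy yv'] : exists2 y, trans s None y & weak y [::] v'.
  have [ls sv lsE] := weak_cat sst tv.
  case: ls sv lsE => [|[a|] ls] //=.
    by move=> -> _; exists v' => //; apply: weak_refl.
  case=> y sy yv lsE; exists y => //; apply: weak_taur vv'.
  by exists ls.
by apply: (IH y sy u) => //; apply: weak_cat yv' v'u.
Qed.

Section InfiniteTraces.
Variables (Act : Type) (L : lts Act) (xi : nat -> Act).
Implicit Types (s t : st L).

Definition wstep (y x : st L * nat) : Prop :=
  y.2 = x.2.+1 /\ weak x.1 [:: xi x.2] y.1.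

Lemma InfP : Inf L xi <-> ~ Acc wstep (init L, 0).
Proof.
split=> [/weak_infP[p [p0 pw]]|nA].
  rewrite -p0; apply: (chain_not_Acc (p := fun n => (p n, n))) => n.
  by split=> //=; apply: pw.
have [q [q0 qw]] := not_Acc_chain nA; apply/weak_infP.
have q2 n : (q n).2 = n by elim: n => [|n IH]; rewrite ?q0 // (qw n).1 IH.
exists (fun n => (q n).1); rewrite q0; split=> // n.
by have [_] := qw n; rewrite q2.
Qed.

(** If [xi] is not an infinite trace, the states met along it are well-founded under progress by at
    least one letter. *)
Lemma winf_ind (Q : st L -> nat -> Prop) :
  (forall s n, weak (init L) (mkseq xi n) s ->
     (forall t m, n < m -> weak s (seg xi n m) t -> Q t m) -> Q s n) ->
  ~ Inf L xi -> forall s n, weak (init L) (mkseq xi n) s -> Q s n.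
Proof.
move=> Qstep nInf s n.
(* Silent moves do not descend in [wstep], so the claim covers everything reachable along [xi] from
   an accessible pair. *)
suff: forall x, Acc wstep x -> weak (init L) (mkseq xi x.2) x.1 ->
    forall m t, x.2 <= m -> weak x.1 (seg xi x.2 m) t -> Q t m.
  move=> H; rewrite -seg0; apply: (H (init L, 0)) => [||//].
    by apply: contrapT => /InfP.
  exact: weak_refl.
move=> x; elim=> -[{}s {}n] _ IH /= sn m t nm st.
have {}IH m' t' : n < m' -> weak s (seg xi n m') t' -> Q t' m'.
  move=> nm'; rewrite seg_cons // => /(@weak_split _ _ [:: _])[u su ut'].
  apply: (IH (u, n.+1)) => //=.
  by rewrite mkseqS -cats1; apply: weak_cat sn su.
move: nm; rewrite leq_eqVlt => /predU1P[nm|nm]; last exact: IH.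
subst m; rewrite segii in st; apply: Qstep => [|t' m' nm' tt'].
  by rewrite -[mkseq _ _]cats0; apply: weak_cat sn st.
by apply: IH => //; apply: weak_cat st tt'.
Qed.

Lemma Inf_coind (P : st L -> nat -> Prop) s n :
  weak (init L) (mkseq xi n) s -> P s n ->
  (forall s n, P s n -> exists2 t, weak s [:: xi n] t & P t n.+1) -> Inf L xi.
Proof.
move=> sn Ps Pstep; apply: contrapT => nI; move: Ps.
apply: (winf_ind (Q := fun s n => ~ P s n)) nI _ _ sn => {}s {}n _ IH.
by move=> /Pstep[t st]; apply: IH; rewrite ?segS.
Qed.

Lemma Inf_weak n : Inf L xi -> exists s, weak (init L) (mkseq xi n) s.
Proof.
move=> /weak_infP[p [p0 pw]]; exists (p n); rewrite -p0.
elim: n => [|n IH]; first exact: weak_refl.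
by rewrite mkseqS -cats1; apply: weak_cat IH (pw n).
Qed.

End InfiniteTraces.

(** * Isomorphism onto a reachable part *)

Section Isomorphism.
Variables (Act : Type) (P T : lts Act) (phi : st P -> st T) (psi : st T -> st P).
Hypothesis phiK : cancel phi psi.
Hypothesis alphE : alph P = alph T.
Hypothesis phi_init : phi (init P) = init T.
Hypothesis phi_trans : forall x l z,
  trans (phi x) l z <-> exists2 y, z = phi y & trans x l y.

Let path_phi x ls z :
  path_of (phi x) ls z <-> exists2 y, z = phi y & path_of x ls y.
Proof.
elim: ls x => [|l ls IH] x /=.
  by split=> [<-|[y -> ->]] //; exists x.
split=> [[u /phi_trans[y -> xy]]|[y zE [u xu uy]]].
  by case/(IH y)=> y' -> yy'; exists y' => //; exists y.
by exists (phi u); [apply/phi_trans; exists u|apply/IH; exists y].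
Qed.

Let weak_phi x w z : weak (phi x) w z <-> exists2 y, z = phi y & weak x w y.
Proof.
split=> [[ls /path_phi[y -> xy] <-]|[y -> [ls xy <-]]].
  by exists y => //; exists ls.
by exists ls => //; apply/path_phi; exists y.
Qed.

Let inf_path_phi x p ls :
  inf_path (phi x) p ls <-> exists2 q, p = phi \o q & inf_path x q ls.
Proof.
split=> [[p0 pt]|[q -> [q0 qt]]]; last first.
  by split=> [|n] /=; [rewrite q0|apply/phi_trans; exists (q n.+1)].
have pE n : p n = phi (psi (p n)).
  elim: n => [|n IH]; first by rewrite p0 phiK.
  by have := pt n; rewrite IH => /phi_trans[y -> _]; rewrite phiK.
exists (psi \o p); first by apply/funext => n; exact: pE.
split=> [|n] /=; first by rewrite p0 phiK.
by have := pt n; rewrite (pE n) => /phi_trans[y -> xy]; rewrite !phiK.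
Qed.

(** The image of [phi] contains the initial state and is closed under transitions, so states outside
    it do not influence the semantics; [psi] pulls infinite paths back. *)
Lemma iso_CFFD : CFFD_eq P T.
Proof.
split=> //.
- apply/predeqP => -[w A]; rewrite /Sf /= -alphE -phi_init.
  split=> -[Asub [x [wx xs xA]]]; split=> //.
    exists (phi x); split; first by apply/weak_phi; exists x.
      by move=> z /phi_trans[y _]; exact: xs.
    by move=> a /xA H z /phi_trans[y _]; exact: H.
  case/weak_phi: wx xs xA => y -> wy xs xA; exists y; split=> //.
    by move=> t yt; apply: (xs (phi t)); apply/phi_trans; exists t.
  by move=> a /xA H t yt; apply: (H (phi t)); apply/phi_trans; exists t.
- apply/predeqP => w; rewrite /Div /= -phi_init; split=> [[x wx [q xq]]|].
    exists (phi x); first by apply/weak_phi; exists x.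
    by exists (phi \o q); apply/inf_path_phi; exists q.
  case=> z /weak_phi[y -> wy] [p /inf_path_phi[q _ yq]].
  by exists y => //; exists q.
- apply/predeqP => xi; rewrite /Inf /= -phi_init.
  split=> -[p [ls [xp v]]].
    by exists (phi \o p), ls; split=> //; apply/inf_path_phi; exists p.
  by case/inf_path_phi: xp => q _ xq; exists q, ls.
Qed.

End Isomorphism.

Lemma seg_const (Act : Type) (c : Act) i n :
  seg (fun=> c) i (i + n) = mkseq (fun=> c) n.
Proof.
rewrite /seg /mkseq addKn; elim: n i 0 => //= n IH i j.
by rewrite (IH _ j.+1).
Qed.

(** * Saturation at divergence traces *)

Section Saturation.
Variables (Act : Type) (L : lts Act) (b : bool).
Implicit Types (s : st L) (w v : seq Act) (a : Act).

(* The driver follows [L] in mode [Real s w], [w] being the trace so far.  In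
   [Wait w] it has abandoned [L] at the divergence trace [w], and in [Run w v] it
   still has to perform [v] to arrive at the divergence trace [w ++ v].  Words [v]
   of any length are allowed if [b], otherwise only words of length one. *)
Inductive mode :=
  Real of st L & seq Act | Wait of seq Act | Run of seq Act & seq Act.

(* The return from [Run] to [L] keeps nondivergent traces free of new stable
   failures. *)
Definition mode_tau m m' : Prop :=
  match m, m' with
  | Real s w, Real s' w' => trans s None s' /\ w' = w
  | Run w _, Real s w' => [/\ w' = w, ~ Div L w & weak (init L) w s]
  | _, _ => False
  end.

Definition mode_act m a m' : Prop :=
  match m, m' with
  | Real s w, Real s' w' => trans s (Some a) s' /\ w' = rcons w a
  | Run w (a' :: v), Run w' v' => [/\ a' = a, alph L a, w' = rcons w a & v' = v]
  | _, _ => False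
  end.

Definition mode_sync m m' : Prop :=
  match m, m' with
  | Real s w, Wait w' => diverges s /\ w' = w
  | Wait w, Run w' v => [/\ w' = w, Div L (w ++ v) & b || (size v == 1)]
  | Run w [::], Wait w' => w' = w
  | _, _ => False
  end.

Variables (c : Act) (X : lts Act).
Implicit Types (x : st X) (z : mode * st X).
Local Notation cs := (fun _ : nat => c).

(** The composition of driver and [X] with [c] already hidden; [sat_contextP] identifies it with an
    actual context. *)
Definition sat_trans (z : mode * st X) l (z' : mode * st X) : Prop :=
  if l is Some a then mode_act z.1 a z'.1 /\ z'.2 = z.2 else
  [\/ mode_tau z.1 z'.1 /\ z'.2 = z.2,
      z'.1 = z.1 /\ trans z.2 None z'.2 |
      mode_sync z.1 z'.1 /\ trans z.2 (Some c) z'.2].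

Lemma sat_trans_alph z a z' : sat_trans z (Some a) z' -> alph L a.
Proof.
case: z z' => -[s w|w|w [|a' v]] x [[s' w'|w'|w' v'] x'] //= [] //.
  by case=> H _ _; apply: trans_alph H.
by case.
Qed.

Definition sat := LTS (Real (init L) [::], init X) sat_trans_alph.

Hypothesis X_stable : forall x, ~ trans (init X) None x.

(* With [b], a nondivergent trace is possible only after an even number of [c]'s,
   and then [X] does not diverge; without [b], [L] is never resumed. *)
Definition inv w z : Prop :=
  match z.1 with
  | Real s w' => [/\ w' = w, weak (init L) w s &
      if b then exists k, weak (init X) (mkseq cs k.*2) z.2 else z.2 = init X]
  | Wait w' => [/\ w' = w, Div L w &
      exists k, weak (init X) (mkseq cs k.*2.+1) z.2]
  | Run w' v => [/\ w' = w, Div L (w ++ v), b \/ Div L w /\ size v <= 1 &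
      exists k, weak (init X) (mkseq cs k.+1.*2) z.2]
  end.

Lemma inv_init : inv [::] (init sat).
Proof.
split=> //; first exact: weak_refl.
by case: (b) => //; exists 0; apply: weak_refl.
Qed.

Let sync_count k x x' : weak (init X) (mkseq cs k) x -> trans x (Some c) x' ->
  weak (init X) (mkseq cs k.+1) x'.
Proof. by rewrite mkseqS; apply: weak_actr. Qed.

(** Each synchronization adds one [c], and the parity follows the mode: odd in [Wait], even
    elsewhere. Without [b], [Run] always stands at a divergence trace, which blocks the return to
    [Real]. *)
Lemma inv_tau w (z z' : st sat) : inv w z -> trans z None z' -> inv w z'.
Proof.
case: z z' => m x [m' x'] /= I [[mm' xx']|[mm' xx']|[mm' xx']]; rewrite /= in mm' xx'.
- subst x'; case: m m' mm' I => [s u|u|u v] [s' u'|u'|u' v'] //=.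
    by case=> ss' -> [/= -> ws I]; split=> //; apply: weak_taur ss'.
  case=> -> nD us' [/= uw D H [k xk]]; subst u; split=> //=.
  by case: (b) H => [_|[//|[/nD []]]]; exists k.+1.
- subst m'; case: m I => [s u|u|u v] /=.
  + case=> /= ? ? H; split=> //=.
    case: (b) H xx' => [[k H] xx'|-> /X_stable //]; exists k.
    exact: weak_taur xx'.
  + by case=> /= ? ? [k H]; split=> //=; exists k; apply: weak_taur xx'.
  + by case=> /= ? ? ? [k H]; split=> //=; exists k; apply: weak_taur xx'.
- case: m m' mm' I => [s u|u|u [|a v]] [s' u'|u'|u' v'] //=.
  + case=> sd -> [/= -> ws I]; split=> //=; first by exists s.
    case: (b) I => [[k xk]|xE]; first by exists k; apply: sync_count xx'.
    by exists 0; apply: sync_count xx'; rewrite xE; apply: weak_refl.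
  + case=> -> D bv [/= uw Dw [k xk]]; subst u; split=> //=; last first.
      by exists k; apply: sync_count xx'.
    by case/orP: bv => [|/eqP->]; [left|right].
  + move=> -> [/= uw D _ [k xk]]; subst u; split=> //=; first by rewrite cats0 in D.
    by exists k.+1; apply: sync_count xx'.
Qed.

Lemma inv_act w a (z z' : st sat) :
  inv w z -> trans z (Some a) z' -> inv (rcons w a) z'.
Proof.
case: z z' => m x [m' x'] /= I [] /= mm' xx'; subst x'.
case: m m' mm' I => [s u|u|u [|a' v]] [s' u'|u'|u' v'] //=.
  by case=> ss' -> [/= -> ws I]; split=> //; apply: weak_actr ss'.
case=> -> al -> -> [/= -> D bD xk]; split; rewrite //= ?cat_rcons //.
case: bD => [|[Dw /= v0]]; [by left|right]; split; last by case: (v) v0.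
by rewrite -cats1; case: (v) v0 D.
Qed.

Lemma inv_weak w0 (z : st sat) w z' : inv w0 z -> weak z w z' -> inv (w0 ++ w) z'.
Proof.
apply: weak_invariant => [w1 y y'|w1 y a y']; [exact: inv_tau|exact: inv_act].
Qed.

Lemma inv_reach w z : weak (init sat) w z -> inv w z.
Proof. exact: (inv_weak inv_init). Qed.

Lemma real_weak x s w s' v : weak s w s' ->
  @weak _ sat (Real s v, x) w (Real s' (v ++ w), x).
Proof.
pose I w s' := @weak _ sat (Real s v, x) w (Real s' (v ++ w), x).
apply: (@weak_invariant _ _ I _ _ [::]).
- by move=> w1 t t' H tt'; apply: weak_taur H _; apply: Or31.
- by move=> w1 t a t' H tt'; apply: weak_actr H _; rewrite /= rcons_cat.
- by rewrite /I cats0; apply: weak_refl.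
Qed.

Lemma real_reach s w : weak (init L) w s ->
  @weak _ sat (init sat) w (Real s w, init X).
Proof. exact: real_weak. Qed.

(** A stable state does not diverge, so the driver cannot abandon it, and [X] is initially
    stable. *)
Lemma sat_Sf_sub : Sf L `<=` Sf sat.
Proof.
case=> w A [/= Asub [s [ws ss sA]]]; split=> //=; exists (Real s w, init X).
split; first exact: real_reach.
  move=> [m' x'] [[/= + _]|[/= _ /X_stable//]|[/= + _]].
    by case: m' => //= s' u' [/ss].
  case: m' => //= u' [[p [p0 pt]] _]; apply: (ss (p 1)).
  by rewrite -p0; apply: pt.
by move=> a /sA H [[s' u'|u'|u' v'] x'] [] //= [/H].
Qed.

(** Constraints on a mode change made without synchronization. A return from [Run] to [Real] is left
    free, because [inv] describes the state reached. *)
Definition quiet m w m' : Prop :=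
  match m, m' with
  | Real s _, Real s' _ => weak s w s'
  | Wait _, Wait _ => w = [::]
  | Run _ v, Run _ v' => v = w ++ v'
  | Run _ _, Real _ _ => True
  | _, _ => False
  end.

(** [k] counts the synchronizations on the way; each happens at a divergence trace. *)
Lemma progress w0 (z : st sat) w (z' : st sat) : inv w0 z -> weak z w z' ->
  exists k, [/\ weak z.2 (mkseq cs k) z'.2, k = 0 -> quiet z.1 w z'.1 &
    0 < k -> exists w1 w2, w = w1 ++ w2 /\ Div L (w0 ++ w1)].
Proof.
move=> Iz; pose I w (z' : st sat) := inv (w0 ++ w) z' /\
  exists k, [/\ weak z.2 (mkseq cs k) z'.2, k = 0 -> quiet z.1 w z'.1 &
    0 < k -> exists w1 w2, w = w1 ++ w2 /\ Div L (w0 ++ w1)].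
suff H : I [::] z -> weak z w z' -> I ([::] ++ w) z'.
  move=> zz'; case: H => //; split; first by rewrite cats0.
  exists 0; split=> //; first exact: weak_refl.
  by case: (z.1) => //= s u _; apply: weak_refl.
apply: weak_invariant => {w z'} [w y y'|w y a y'] [Iy [k [zy q d]]] yy'.
- split; first exact: inv_tau yy'.
  case: (yy') => [[/= yy1 ->]|[/= -> yy2]|[/= yy1 yy2]].
  + exists k; split=> // /q.
    move: (z.1) (y.1) (y'.1) yy1 => [s u|u|u v] [s' u'|u'|u' v'];
      move=> [s'' u''|u''|u'' v''] //= [] ss _ //.
    by move=> H; apply: weak_taur ss.
  + by exists k; split=> //; apply: weak_taur yy2.
  + exists k.+1; split=> //; first by rewrite mkseqS; apply: weak_actr yy2.
    move=> _; exists w, [::]; rewrite cats0; split=> //.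
    case: y y' yy1 {q d zy yy' yy2} Iy => -[s u|u|u [|a v]] x [[s' u'|u'|u' v'] x'] //=.
    * by case=> sd _ [/= _ ws _]; exists s.
    * by move=> _ [].
    * by move=> _ [/= _]; rewrite cats0.
- split; first by have := inv_act Iy yy'; rewrite rcons_cat.
  case: yy' => yy1 ->; exists k; split=> // [/q{d}|/d{q} [w1 [w2 [-> D]]]].
    move: (z.1) (y.1) (y'.1) yy1 => [s u|u|u v] [s' u'|u'|u' [|a' v']];
      move=> [s'' u''|u''|u'' v''] //=.
    * by case=> ss _ H; apply: weak_actr ss.
    * by case=> -> _ _ -> ->; rewrite cat_rcons.
  by exists w1, (rcons w2 a); rewrite rcons_cat.
Qed.

Section InfiniteTraces.
Variable xi : nat -> Act.

(** Quiet steps cannot follow [xi] forever: [Real] copies [L], [Wait] performs no letter, and [Run]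
    exhausts a finite word or returns to [Real]. [Good] carries what a caller must know to deal with
    the other steps. *)
Lemma quiet_Acc (Good : st sat -> nat -> Prop) :
  (forall (z : st sat) n (z' : st sat),
     Good z n -> inv (mkseq xi n) z -> weak z [:: xi n] z' ->
     Acc (wstep xi) (z', n.+1) \/ quiet z.1 [:: xi n] z'.1 /\ Good z' n.+1) ->
  ~ Inf L xi ->
  forall (z : st sat) n, Good z n -> inv (mkseq xi n) z -> Acc (wstep xi) (z, n).
Proof.
move=> step nI.
have next (z : st sat) n : Good z n -> inv (mkseq xi n) z ->
    (forall z' : st sat, quiet z.1 [:: xi n] z'.1 -> Good z' n.+1 ->
      inv (mkseq xi n.+1) z' -> Acc (wstep xi) (z', n.+1)) ->
    Acc (wstep xi) (z, n).
  move=> gz Iz H; constructor=> -[z' n'] [/= -> zz'].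
  have [|[q gz']] := step _ _ _ gz Iz zz'; first exact.
  by apply: H q gz' _; rewrite mkseqS -cats1; apply: inv_weak zz'.
have Areal s n : weak (init L) (mkseq xi n) s -> forall w x, Good (Real s w, x) n ->
    inv (mkseq xi n) (Real s w, x) -> Acc (wstep xi) (((Real s w, x) : st sat), n).
  pose Q s n := forall w x, Good (Real s w, x) n ->
    inv (mkseq xi n) (Real s w, x) -> Acc (wstep xi) (((Real s w, x) : st sat), n).
  apply: (winf_ind (Q := Q)) nI _ _ => {}s {}n sn IH w x gz Iz.
  apply: (next _ _ gz Iz) => -[[s' u'|u'|u' v'] x'] /= ss' gz' Iz'.
  - by apply: (IH _ _ (ltnSn n) _ _ _ gz' Iz'); rewrite segS.
  - by case: ss'.
  - by case: ss'.
case=> -[s u|u|u v] x n gz Iz.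
- by case: (Iz) => _ sn _; apply: (Areal _ _ sn _ _ gz Iz).
- by apply: (next _ _ gz Iz) => -[[s' u'|u'|u' v'] x'] [].
- elim: v u x n gz Iz => [|a v IH] u x n gz Iz;
    apply: (next _ _ gz Iz) => -[[s' u'|u'|u' v'] x'] /= q gz' Iz'.
  + by case: (Iz') => _ sn _; apply: (Areal _ _ sn _ _ gz' Iz').
  + by case: q.
  + by case: q.
  + by case: (Iz') => _ sn _; apply: (Areal _ _ sn _ _ gz' Iz').
  + by case: q.
  + by case: q gz' Iz' => _ <-; apply: IH.
Qed.

Definition recurrent : Prop :=
  if b then forall n, exists2 i, n <= i & Div L (mkseq xi i)
  else exists n, forall i, n <= i -> Div L (mkseq xi i).

(** Otherwise induction along the [c]-traces of [X] bounds the synchronizations, and between them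
    [quiet_Acc] applies. *)
Lemma sat_Inf_sub_X : Inf sat xi -> ~ Inf L xi -> Inf X cs.
Proof.
move=> /InfP nA nI; apply: contrapT => nX; apply: nA.
suff: forall x k, weak (init X) (mkseq cs k) x -> forall n (m : mode),
    inv (mkseq xi n) (m, x) -> Acc (wstep xi) (((m, x) : st sat), n).
  by move/(_ _ 0 (weak_refl _)); apply; apply: inv_init.
apply: (winf_ind (Q := fun x _ => forall n m, inv (mkseq xi n) (m, x) ->
  Acc (wstep xi) (((m, x) : st sat), n))) nX => x k xk IH n m.
apply: (@quiet_Acc (fun z _ => weak x [::] z.2) _ nI (m, x) n (weak_refl x)).
move=> {n m} z n z' xz Iz zz'; have [j [zj q _]] := progress Iz zz'.
have Iz' : inv (mkseq xi n.+1) z' by rewrite mkseqS -cats1; apply: inv_weak zz'.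
case: j zj q => [|j] zj q; first by right; split; [exact: q|exact: weak_cat xz zj].
left; case: z' zz' Iz' zj {q} => m' x' zz' Iz' zj.
apply: (IH _ (k + j.+1)) Iz'; first by rewrite addnS ltnS leq_addr.
by rewrite seg_const; exact: weak_cat xz zj.
Qed.


Let next_inv n (z z' : st sat) :
  inv (mkseq xi n) z -> weak z [:: xi n] z' -> inv (mkseq xi n.+1) z'.
Proof. by rewrite mkseqS -cats1; apply: inv_weak. Qed.

Lemma sat_Inf_sub_recurrent : Inf sat xi -> ~ Inf L xi -> recurrent.
Proof.
move=> /InfP nA nI; apply: contrapT => nr; apply: nA.
suff: forall (z : st sat) n, inv (mkseq xi n) z -> Acc (wstep xi) (z, n).
  by apply; apply: inv_init.
move: nr; rewrite /recurrent; case: (boolP b) => [bT|bF] nr.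
  have [N NP] : exists N, forall n, N <= n -> ~ Div L (mkseq xi n).
    apply: contrapT => H; apply: nr => n; apply: contrapT => nD; apply: H.
    by exists n => i ni Di; apply: nD; exists i.
  (* A step over one letter could synchronize only at the prefixes of length [n] and [n.+1], neither
     of which is divergent beyond [N]. *)
  have late (z : st sat) n : N <= n -> inv (mkseq xi n) z -> Acc (wstep xi) (z, n).
    apply: (quiet_Acc (Good := fun _ n => N <= n) _ nI) => {z n} z n z' Nn Iz zz'.
    right; split; last exact: leqW.
    have [[|k] [_ q d]] := progress Iz zz'; first exact: q.
    have [//|[|a [|a' w1]] [w2 [wE D]]] := d.
    - by rewrite cats0 in D; case: (NP _ Nn).
    - by case: wE D => <- _; rewrite cats1 -mkseqS => /NP []; apply: leqW.
    - by case: wE.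
  move=> z n; have [d] := ubnP (N - n).
  elim: d z n => [z n|d IH z n dN Iz]; first by rewrite ltn0.
  have [Nn|nN] := leqP N n; first exact: late.
  constructor=> -[z' n'] [/= -> zz']; apply: IH (next_inv Iz zz').
  by lia.
have nxt n : exists2 i, n <= i & ~ Div L (mkseq xi i).
  apply: contrapT => H; apply: nr; exists n => i ni; apply: contrapT => nD.
  by apply: H; exists i.
pose isreal (z : st sat) := if z.1 is Real _ _ then true else false.
have nonreal_inv w (z : st sat) : inv w z -> ~~ isreal z -> Div L w.
  by case: z => -[s u|u|u v] x [] //= _ _; rewrite (negbTE bF) => -[//|[]].
(* Without [b], a run that has left [Real] never returns. *)
have stay w0 (z : st sat) w (z' : st sat) : inv w0 z -> weak z w z' ->
    if z'.1 is Real s' _ then if z.1 is Real s _ then weak s w s' else False else True.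
  move=> Iz; pose I w (z' : st sat) := inv (w0 ++ w) z' /\
    if z'.1 is Real s' _ then if z.1 is Real s _ then weak s w s' else False else True.
  suff H : I [::] z -> weak z w z' -> I ([::] ++ w) z'.
    move=> zz'; case: H => //; split; first by rewrite cats0.
    by case: (z.1) => // s u; apply: weak_refl.
  apply: weak_invariant => {w z'} [w y y'|w y a y'] [Iy H] yy'.
    split; first exact: inv_tau yy'.
    case: y y' H yy' Iy => m x [m' x'] /= H [[/= mm' _]|[/= -> _]//|[/= mm' _]].
      case: m m' (z.1) mm' H => [s u|u|u v] [s' u'|u'|u' v'] // [s0 u0|u0|u0 v0] //= [].
        by move=> ss' _ H _; apply: weak_taur ss'.
      1-3: by move=> _ nD _ H [/= <- _]; rewrite (negbTE bF) => -[//|[/nD]].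
    by case: m m' mm' {H} => [s u|u|u [|a v]] [].
  split; first by have := inv_act Iy yy'; rewrite rcons_cat.
  case: y y' H yy' {Iy} => m x [m' x'] /= H [/= mm' _].
  case: m m' (z.1) mm' H => [s u|u|u [|a' v]] [s' u'|u'|u' v'] //
    [s0 u0|u0|u0 v0] //= [].
  by move=> ss' _ H; apply: weak_actr ss'.
(* Outside [Real] all prefixes are divergent, so the run dies out before the next nondivergent
   one. *)
have post n (z : st sat) : inv (mkseq xi n) z -> ~~ isreal z -> Acc (wstep xi) (z, n).
  have [i ni nD] := nxt n; move: ni; have [d] := ubnP (i - n).
  elim: d n z => [n z|d IH n z dn ni Iz nz]; first by rewrite ltn0.
  constructor=> -[z' n'] [/= -> zz'].
  have lt : n < i.
    rewrite ltn_neqAle ni andbT; apply/eqP => nE; apply: nD; rewrite -nE.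
    exact: nonreal_inv Iz nz.
  apply: (IH _ _ _ lt (next_inv Iz zz')); first by lia.
  have := stay _ _ _ _ Iz zz'; move: nz; rewrite /isreal.
  by case: (z.1) (z'.1) => [? ?|?|? ?] [].
move=> z n; apply: (@quiet_Acc (fun _ _ => True) _ nI z n I) => {z n} z n z' _ Iz zz'.
have Iz' := next_inv Iz zz'.
have [rz'|nz'] := boolP (isreal z'); last by left; apply: post.
right; split=> //; have := stay _ _ _ _ Iz zz'; move: rz'; rewrite /isreal.
by case: (z.1) (z'.1) => [? ?|?|? ?] [].
Qed.

Lemma sat_Inf_sup : Inf L xi -> Inf sat xi.
Proof.
move=> /weak_infP[p [p0 pw]]; apply/weak_infP.
exists (fun n => (Real (p n) (mkseq xi n), init X)); split; first by rewrite p0.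
by move=> n; rewrite mkseqS -cats1; apply: real_weak.
Qed.

Lemma sync_weak m m' x x' : mode_sync m m' -> weak x [:: c] x' ->
  @weak _ sat (m, x) [::] (m', x').
Proof.
move=> mm' xx'.
have xtau m1 y y' : weak y [::] y' -> @weak _ sat (m1, y) [::] (m1, y').
  by apply: (@weak_lift _ X sat (pair m1)) => u v uv; apply: Or32.
have [y [y' [xy yy' y'x']]] := weak_consE xx'.
rewrite -[[::]]/([::] ++ [::]); apply: weak_cat (xtau _ _ _ xy) _.
by apply: weak_taul (xtau _ _ _ y'x'); apply: Or33.
Qed.

(** The run jumps from one divergent prefix to a later one. A jump costs two [c]'s, one into [Wait]
    and one into [Run]; the first starts from [Real], whence [p 2] below. *)
Lemma sat_Inf_recurrent : Inf X cs -> recurrent -> Inf sat xi.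
Proof.
move=> /weak_infP[p [p0 pw]] rec.
have [i0 D0 nxt] : exists2 i0, Div L (mkseq xi i0) & forall i, i0 <= i ->
    exists j, [/\ i < j, Div L (mkseq xi j) & b || (size (seg xi i j) == 1)].
  move: rec; rewrite /recurrent; case: (b) => [H|[n H]].
    have [i0 _ D0] := H 0; exists i0 => // i _.
    by have [j ij Dj] := H i.+1; exists j.
  exists n; first exact: H.
  by move=> i ni; exists i.+1; split=> //; [apply/H/leqW|rewrite segS].
pose P (z : st sat) n := exists j k, [/\ i0 <= n <= j, Div L (mkseq xi j) &
  z = (Run (mkseq xi n) (seg xi n j), p k)].
case: (D0) => s ws sd.
have [j0 [ij0 Dj0 ok0]] := nxt _ (leqnn i0).
apply: (@Inf_coind _ sat xi P (Run (mkseq xi i0) (seg xi i0 j0), p 2) i0).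
- rewrite -[mkseq xi i0]cats0; apply: weak_cat (real_reach ws) _.
  rewrite cats0 -p0 -[[::]]/([::] ++ [::]).
  apply: weak_cat (sync_weak (m' := Wait (mkseq xi i0)) _ (pw 0)) _.
    by split=> //; exists sd.
  apply: sync_weak (pw 1); split=> //; by rewrite mkseq_seg // ltnW.
- by exists j0, 2; split=> //; rewrite leqnn ltnW.
move=> z n [j [k [/andP[i0n nj] Dj ->]]].
have step j' k' : n < j' -> Div L (mkseq xi j') ->
    exists2 t, @weak _ sat (Run (mkseq xi n) (seg xi n j'), p k') [:: xi n] t &
      P t n.+1.
  move=> nj' Dj'; exists (Run (mkseq xi n.+1) (seg xi n.+1 j'), p k').
    apply: weak_act; rewrite seg_cons //.
    split=> //; split=> //; last by rewrite mkseqS.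
    case: Dj' => t + _; rewrite -(mkseq_seg xi (ltnW nj')) seg_cons //.
    exact: weak_alph.
  by exists j', k'; split=> //; rewrite leqW.
move: nj; rewrite leq_eqVlt => /predU1P[nE|nj]; last exact: step.
have [j' [nj' Dj' ok]] := nxt n i0n; have [t H Pt] := step j' k.+2 nj' Dj'.
exists t => //; rewrite -nE segii -[[:: _]]/([::] ++ [:: _]).
apply: weak_cat (sync_weak (m' := Wait (mkseq xi n)) _ (pw k)) _ => //.
rewrite -[[:: _]]/([::] ++ [:: _]); apply: weak_cat (sync_weak _ (pw k.+1)) H.
by split=> //; rewrite mkseq_seg // ltnW.
Qed.

End InfiniteTraces.

Hypothesis X_even : b -> forall k, ~ Div X (mkseq cs k.*2).

(** At a nondivergent trace nothing synchronizes silently. What remains is at most one return to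
    [Real] and the tau steps of [L] and [X]; those of [X] terminate by [X_even] or, without [b], by
    initial stability. *)
Lemma nondiv_Acc w z : inv w z -> ~ Div L w -> Acc (@tau_below _ sat) z.
Proof.
move=> I nD.
have Dreal : forall x, Acc (@tau_below _ X) x -> forall s,
    Acc (@tau_below _ L) s -> weak (init L) w s -> Acc (@tau_below _ sat) (Real s w, x).
  move=> x; elim=> {}x _ IHx s; elim=> {}s As IHs ws.
  constructor=> -[m' x'] [[/= mm' xx']|[/= mm' xx']|[/= mm' xx']].
  - subst x'; case: m' mm' => [s' u'|u'|u' v'] [] ss' ->.
    by apply: (IHs _ ss'); apply: weak_taur ss'.
  - by subst m'; apply: (IHx _ xx' _ _ ws); constructor.
  - case: m' mm' => [s' u'|u'|u' v'] [] sd _.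
    by case: nD; exists s.
have Dx k x : weak (init X) (mkseq cs k.*2) x -> b -> Acc (@tau_below _ X) x.
  by move=> xk bT; apply: (Div_diverges xk); apply: X_even.
case: z I => -[s u|u|u v] x [/= -> D H].
- apply: Dreal (Div_diverges D nD) D.
  move: H (fun k => Dx k x); case: (b) => [[k xk] H|-> _]; first exact: (H k).
  exact: stable_Acc.
- by case: nD.
- case: H => [bT|[/nD []]] [k xk].
  have := Dx _ _ xk bT; move: x {xk} => x; elim=> {}x Ax IH.
  constructor=> -[m' x'] [[/= mm' xx']|[/= mm' xx']|[/= mm' xx']].
  + subst x'; case: m' mm' => [s' u'|u'|u' v'] [] -> _ ws'.
    exact: Dreal (Acc_intro _ Ax) _ (Div_diverges ws' nD) ws'.
  + by subst m'; apply: IH.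
  + by case: (v) D mm'; rewrite ?cats0.
Qed.

Lemma sat_Div : Div sat = Div L.
Proof.
apply/predeqP => w; split=> [[z wz /divergesP zd]|[s ws [p [p0 pt]]]].
  by apply: contrapT => nD; apply: zd; apply: nondiv_Acc (inv_reach wz) nD.
exists (Real s w, init X); first exact: real_reach.
exists (fun n => (Real (p n) w, init X)); rewrite /inf_path p0; split=> // n.
by apply: Or31; split=> //; split=> //; apply: pt.
Qed.

(** [Run] is unstable here: [w] is a prefix of a divergence trace, hence a trace of [L], and the
    return to [Real] is enabled. *)
Lemma sat_stable_Real w z : inv w z -> (forall z', ~ @trans _ sat z None z') ->
  ~ Div L w -> exists2 s, weak (init L) w s & z = (Real s w, z.2).
Proof.
case: z => -[s u|u|u v] x [].
- by move=> /= -> ws _ _ _; exists s.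
- by move=> /= _ D _ _ /(_ D).
move=> /= -> D _ _ zs nD; have [s ws] := Div_weak D; case: (zs (Real s w, x)).
exact: Or31.
Qed.

Lemma real_stable s w x :
  (forall z', ~ @trans _ sat (Real s w, x) None z') -> forall s', ~ trans s None s'.
Proof. by move=> H s' ss'; apply: (H (Real s' w, x)); apply: Or31. Qed.

Lemma real_refuse a s w x :
  (forall z', ~ @trans _ sat (Real s w, x) (Some a) z') ->
  forall s', ~ trans s (Some a) s'.
Proof. by move=> H s' ss'; apply: (H (Real s' (rcons w a), x)). Qed.

Lemma sat_nF : nF sat = nF L.
Proof.
apply/predeqP => -[w A]; rewrite /nF /= sat_Div; split=> -[+ nD]; split=> //.
  case: a => /= Asub [z [wz zs zA]]; split=> //=.
  have [s ws zE] := sat_stable_Real (inv_reach wz) zs nD.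
  rewrite zE in zs zA; exists s; split=> //; first exact: real_stable zs.
  by move=> a /zA /real_refuse.
exact: sat_Sf_sub.
Qed.

End Saturation.

(** * Saturation as a context around [X] *)

Section SaturationContext.
Variables (Act : Type) (h : Act -> Act) (c : Act).
Hypothesis h_inj : injective h.
Hypothesis hNc : forall a, h a <> c.
Variables (L : lts Act) (b : bool).

(** Renaming the letters of [L] by [h] frees [c] for synchronization. [L] is built into the driver,
    as the congruence is applied only in the place of [X]. *)
Definition driver_trans (m : mode L) l (m' : mode L) : Prop :=
  match l with
  | None => mode_tau m m'
  | Some y => y = c /\ mode_sync b m m' \/ exists2 a, y = h a & mode_act m a m'
  end.

Lemma driver_trans_alph m y m' : driver_trans m (Some y) m' ->
  (h @` alph L `|` [set c]) y.
Proof.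
case=> [[-> _]|[a -> H]]; [by right|left; exists a => //].
exact: (@sat_trans_alph _ _ b c L (m, init L) a (m', init L)).
Qed.

Definition driver : lts Act := LTS (Real (init L) [::]) driver_trans_alph.

Definition unh : set (Act * Act) := [set p | p.1 = h p.2].

Definition sat_context (X : lts Act) := rename (Defs.hide (par driver X) [set c]) unh.

Lemma sat_contextP X : alph X = [set c] -> CFFD_eq (sat L b c X) (sat_context X).
Proof.
move=> alX.
apply: (@iso_CFFD _ (sat L b c X) (sat_context X) (fun z => z) (fun z => z)) => //.
  apply/predeqP => a; split=> [La|[y [/= [[[a' La' <-]|yc]|yX] yn]]].
  - exists (h a); last by left.
    by split; [left; left; exists a|exact: hNc].
  - by case=> [/h_inj /= <- //|[_]]; case; exists a'.
  - by case: yn.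
  - by rewrite alX in yX; case: yn.
case=> m x l [m' x'].
have Xc y : in_alph X (Some y) <-> y = c by rewrite /= alX.
case: l => [a|]; split.
- case=> y [/= [[_ /Xc //]|[_ dt /= xx]|[_ xt _]] yc] r; last first.
    by case: yc; apply/Xc; apply: trans_alph xt.
  exists (m', x') => //; split=> //=; case: dt => [[//]|[a' ya H]].
  by case: r => [/=|[_ []]]; [rewrite /unh /= ya => /h_inj <-|exists a'].
- case=> _ <- [/= act xx]; exists (h a); last by left.
  split; last exact: hNc.
  apply: Or32; split=> //=; first by move/Xc/hNc.
  by right; exists a.
- case=> [[[//]|[_ /= mt xx]|[_ /= xt mm]]|[_ -> [[_ _ dt xt]|[]|[]]]].
  + by exists (m', x') => //; apply: Or31.
  + by exists (m', x') => //; apply: Or32.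
  + exists (m', x') => //; apply: Or33; split=> //=.
    by case: dt => [[]//|[a /esym/hNc]].
  + by case; apply/Xc.
  + by case; right.
- case=> _ <- [[/= mt xx]|[/= mm xt]|[/= ms xt]].
  + by left; apply: Or32; split=> //.
  + by left; apply: Or33; split=> //.
  + right; exists c => //; apply: Or31; split=> //; [by right|exact/Xc|].
    by left.
Qed.

Lemma sat_cong R X1 X2 : congruence R ->
  (forall L1 L2 : lts Act, CFFD_eq L1 L2 -> R L1 L2) ->
  alph X1 = [set c] -> alph X2 = [set c] -> R X1 X2 ->
  R (sat L b c X1) (sat L b c X2).
Proof.
move=> Rc RC al1 al2 RX; have [_ Rsym Rtrans] := cong_equiv Rc.
apply: (Rtrans _ _ _ (RC _ _ (sat_contextP al1))).
apply: (Rtrans _ (sat_context X2)); last exact: Rsym (RC _ _ (sat_contextP al2)).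
by apply: (cong_rename Rc); apply: (cong_hide Rc); apply: (cong_parr Rc).
Qed.


End SaturationContext.

(** * Traces behind an action prefix *)

Section Prefix.
Variables (Act : Type) (c : Act) (Y : lts Act).
Local Notation X := (Defs.prefix c Y).
Local Notation cs := (fun _ : nat => c).

Lemma weak_prefix w (z : st X) : weak (init X) w z ->
  w = [::] /\ z = None \/
  exists w' y, [/\ w = c :: w', z = Some y & weak (init Y) w' y].
Proof.
pose I w (z : st X) := w = [::] /\ z = None \/
  exists w' y, [/\ w = c :: w', z = Some y & weak (init Y) w' y].
have I0 : I [::] (init X) by left.
apply: (weak_invariant (I := I)) I0 => {w z} [w s t|w s a t].
- case=> [[-> ->]|[w' [y [-> -> wy]]]]; case: t => //= t; first by case.
  by move=> yt; right; exists w', t; split=> //; apply: weak_taur yt.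
- case=> [[-> ->]|[w' [y [-> -> wy]]]]; case: t => //= t.
    case=> -[->] ->; right; exists [::], (init Y); split=> //; exact: weak_refl.
  by move=> yt; right; exists (rcons w' a), t; split=> //; apply: weak_actr yt.
Qed.

Lemma prefix_stable (z : st X) : ~ trans (init X) None z.
Proof. by case: z => //= y []. Qed.

Lemma prefix_nil_Div : ~ Div X [::].
Proof.
case=> z wz [p [p0 pt]]; have [[_ zE]|[? [? []]]//] := weak_prefix wz.
by have H := pt 0; rewrite p0 zE in H; apply: prefix_stable H.
Qed.

Lemma prefix_weak s w t : weak s w t -> @weak _ X (Some s) w (Some t).
Proof.
pose I w t := @weak _ X (Some s) w (Some t).
apply: (@weak_invariant _ _ I _ _ [::]) => [w1 u v|w1 u a v|].
- by move=> H uv; apply: weak_taur H _.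
- by move=> H uv; apply: weak_actr H _.
- exact: weak_refl.
Qed.

Lemma prefix_Div w : Div X (c :: w) <-> Div Y w.
Proof.
split=> [[z /weak_prefix[[]//|[_ [y [[<-] -> wy]]]] /divergesP zd]|[y wy [p [p0 pt]]]].
  exists y => //; apply/divergesP => yA; apply: zd; elim: yA => {wy}y _ IH.
  by constructor=> -[t yt|[]]; apply: IH.
exists (Some y).
  by apply: (@weak_actl _ X c w None (Some (init Y)) (Some y) _ (prefix_weak wy)).
by exists (fun n => Some (p n)); rewrite /inf_path p0.
Qed.

Lemma prefix_weakE s w (z : st X) : weak (L := X) (Some s) w z ->
  exists2 t, z = Some t & weak s w t.
Proof.
pose I w (z : st X) := exists2 t, z = Some t & weak s w t.
apply: (@weak_invariant _ _ I _ _ [::]) => [w1 u v|w1 u a v|].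
- by case=> t -> st; case: v => //= v tv; exists v => //; apply: weak_taur tv.
- by case=> t -> st; case: v => //= v tv; exists v => //; apply: weak_actr tv.
- by exists s => //; apply: weak_refl.
Qed.

Lemma prefix_Inf : Inf X cs <-> Inf Y cs.
Proof.
split=> /weak_infP[p [p0 pw]]; last first.
  apply/weak_infP; exists (fun n => if n is n'.+1 then Some (p n') else None).
  split=> // -[|n]; last exact: prefix_weak.
  by rewrite p0; apply: weak_act.
pose P t n := exists2 y, p n.+1 = Some y & weak t [::] y.
apply: (@Inf_coind _ _ cs P (init Y) 0); first exact: weak_refl.
  have := pw 0; rewrite p0 => /weak_prefix[[]//|[_ [y [[<-] yE wy]]]].
  by exists y.
move=> t n [y yE ty]; have := pw n.+1; rewrite yE => /prefix_weakE[y' y'E yy'].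
exists y'; first exact: weak_cat ty yy'.
by exists y' => //; apply: weak_refl.
Qed.

End Prefix.

(** * Saturation with [V] and with [B] *)

Section SaturateVB.
Variables (Act : Type) (c : Act) (L : lts Act).
Local Notation cs := (fun _ : nat => c).

Lemma V_weak w s : weak (init (V Act)) w s -> w = [::].
Proof.
case=> ls; elim: ls (init _) => [|[a|] ls IH] t /=; first by move=> _ <-.
  by case=> u.
by case=> u _ /IH.
Qed.

Lemma B_weak w s : weak (init (B Act)) w s -> w = [::].
Proof.
case=> ls; elim: ls (init _) => [|[a|] ls IH] t /=; first by move=> _ <-.
  by case=> u [].
by case=> u _ /IH.
Qed.

Lemma prefix_short_even (Y : lts Act) :
  (forall w s, weak (init Y) w s -> w = [::]) ->
  forall k, ~ Div (Defs.prefix c Y) (mkseq cs k.*2).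
Proof.
move=> Y0 [|k]; rewrite ?doubleS; first exact: prefix_nil_Div.
case=> z wz _; have [[]//|[w [y [wE _ wy]]]] := weak_prefix wz.
by rewrite (Y0 _ _ wy) in wE.
Qed.

Lemma short_no_Inf (Y : lts Act) :
  (forall w s, weak (init Y) w s -> w = [::]) -> ~ Inf Y cs.
Proof. by move=> Y0 iY; have [s ws] := Inf_weak 1 iY; have := Y0 _ _ ws. Qed.

(** After its single [c], [V] loops silently beside a driver stuck in [Wait]: no new stable state
    arises, and the trace was divergent anyway. *)
Lemma sat_V_CFFD : CFFD_eq L (sat L true c (Defs.prefix c (V Act))).
Proof.
have st := @prefix_stable _ c (V Act).
have ev : true -> forall k, ~ Div (Defs.prefix c (V Act)) (mkseq cs k.*2).
  by move=> _; apply: prefix_short_even; apply: V_weak.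
split=> //; last 2 first.
- by rewrite sat_Div.
- apply/predeqP => xi; split=> [|H]; last first.
    apply: contrapT => nI; have := sat_Inf_sub_X st H nI.
    by rewrite prefix_Inf; apply: short_no_Inf; apply: V_weak.
  exact: sat_Inf_sup.
- apply/predeqP => wA; split; first exact: sat_Sf_sub.
  case: wA => w A [Asub [z [wz zs zA]]]; split=> //.
  have := inv_reach st wz; case: z wz zs zA => -[s u|u|u v] x wz zs zA [].
  + move=> _ ws _; exists s; split=> //; first exact: real_stable zs.
    by move=> a aA; apply: real_refuse (zA _ aA).
  + move=> _ _ [k /= xk]; have [[]//|[w' [y [_ xE _]]]] := weak_prefix xk.
    by case: (zs (Wait _ u, Some y)); apply: Or32; rewrite /= xE.
  + move=> _ _ _ [k /= xk]; have [[]//|[w' [y [wE _ wy]]]] := weak_prefix xk.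
    by rewrite (V_weak wy) in wE.
Qed.

Lemma sat_B : [/\ alph (sat L true c (Defs.prefix c (B Act))) = alph L,
  Div (sat L true c (Defs.prefix c (B Act))) = Div L,
  Inf (sat L true c (Defs.prefix c (B Act))) = Inf L &
  Sf (sat L true c (Defs.prefix c (B Act))) =
    nF L `|` [set wA | Div L wA.1 /\ wA.2 `<=` alph L]].
Proof.
have st := @prefix_stable _ c (B Act).
have ev : true -> forall k, ~ Div (Defs.prefix c (B Act)) (mkseq cs k.*2).
  by move=> _; apply: prefix_short_even; apply: B_weak.
split=> //; first by rewrite sat_Div.
  apply/predeqP => xi; split=> [H|]; last exact: sat_Inf_sup.
  apply: contrapT => nI; have := sat_Inf_sub_X st H nI.
  by rewrite prefix_Inf; apply: short_no_Inf; apply: B_weak.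
apply/predeqP => -[w A]; split=> [H|[]].
- have [D|D] := pselect (Div L w); first by right; split=> //; case: H.
  left; have : nF (sat L true c (Defs.prefix c (B Act))) (w, A).
    by split=> //; rewrite sat_Div.
  by rewrite sat_nF.
- by case=> + _; apply: sat_Sf_sub.
- case=> /= -[s ws sd] Asub; split=> //=.
  (* [true] is the deadlock of [B], beside which the waiting driver is stable and refuses
     everything. *)
  exists (Wait _ w, Some true); split.
  + have Bw : weak (init (Defs.prefix c (B Act))) [:: c] (Some true).
      apply: (@weak_actl _ (Defs.prefix c (B Act)) c [::] None (Some false)) => //.
      exact: weak_tau.
    have sw : mode_sync true (Real s w) (Wait L w) by [].
    by have := weak_cat (real_reach true c _ ws) (sync_weak sw Bw); rewrite cats0.
  + move=> [m' x'] [[/=]|[/= _]|[/= _]]; [by case: m'| |];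
    by case: x' => [y []|].
  + by move=> a _ [m' x'] [/=]; case: m'.
Qed.

End SaturateVB.

(** [L] is congruent to its saturation with [V], hence to that with [B], whose stable failures are
    determined by the alphabet, [nF] and [Div]. *)
Lemma CFFD_modulo_VB (Act : Type) (R : lts Act -> lts Act -> Prop)
    (h : Act -> Act) (c : Act) : injective h -> (forall a, h a <> c) ->
  congruence R -> (forall L1 L2 : lts Act, CFFD_eq L1 L2 -> R L1 L2) ->
  R (V Act) (B Act) ->
  forall L1 L2 : lts Act,
    induced (@alph Act) (@nF Act) (@Div Act) (@Inf Act) L1 L2 -> R L1 L2.
Proof.
move=> h_inj hc Rc RC RVB L1 L2 [alE nE dE iE].
have [_ Rsym Rtrans] := cong_equiv Rc.
have LB L : R L (sat L true c (Defs.prefix c (B Act))).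
  apply: (Rtrans _ _ _ (RC _ _ (sat_V_CFFD c L))).
  apply: (sat_cong h_inj hc) => //=; try by rewrite set0U.
  exact: cong_prefix.
apply: (Rtrans _ _ _ (LB L1)); apply: (Rtrans _ _ _ _ (Rsym _ _ (LB L2))).
apply: RC; have [a1 d1 i1 s1] := sat_B c L1; have [a2 d2 i2 s2] := sat_B c L2.
by split; rewrite ?a1 ?a2 ?s1 ?s2 ?d1 ?d2 ?i1 ?i2 // nE dE alE.
Qed.

(** * Probing a system along an infinite word *)

Section Probe.
Variables (Act : Type) (L : lts Act) (xi : nat -> Act).
Variables (F : Type) (f0 : F) (mv : F -> F -> Prop) (jc : nat -> F -> F -> Prop).
Variable c : Act.
Implicit Types (s : st L) (f : F).

(* A tester with control states [F] runs along [xi], performing it invisibly.  It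
   may advance when [mv] holds and show a [c] when [jc] holds.  The branch to
   [Stop] makes ([c], set0) a stable failure in any case, so that membership in nF
   only depends on divergence. *)
Inductive probe_state := Start | Stop | At of st L & nat & F.

Definition probe_trans z l z' : Prop :=
  match z, l, z' with
  | Start, Some a, Stop => a = c
  | Start, None, At s i f => [/\ s = init L, i = 0 & f = f0]
  | At s i f, None, At s' i' f' =>
      [/\ trans s None s', i' = i & f' = f] \/
      [/\ trans s (Some (xi i)) s', i' = i.+1 & mv f f']
  | At s i f, Some a, At s' i' f' => [/\ a = c, s' = s, i' = i & jc i f f']
  | _, _, _ => False
  end.

Lemma probe_trans_alph z a z' : probe_trans z (Some a) z' -> [set c] a.
Proof. by case: z z' => [||s i f] [||s' i' f'] //= []. Qed.

Definition probe : lts Act := LTS Start probe_trans_alph.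

Lemma probe_reach w z : @weak _ probe Start w z ->
  match z with Start => w = [::] | Stop => True
  | At s i _ => weak (init L) (mkseq xi i) s end.
Proof.
pose I (w : seq Act) z := match z with Start => w = [::] | Stop => True
  | At s i _ => weak (init L) (mkseq xi i) s end.
suff: @weak _ probe Start w z -> I ([::] ++ w) z by [].
apply: weak_invariant => //.
  move=> {w z} w [||s i f] [||s' i' f'] //=.
    by move=> _ [-> -> _]; apply: weak_refl.
  move=> si [[ss' -> _]|[ss' -> _]]; first exact: weak_taur ss'.
  by rewrite mkseqS; apply: weak_actr ss'.
by move=> {w z} w [||s i f] a [||s' i' f'] //= si [_ -> ->].
Qed.

Lemma probe_weak s t i j f : mv f f -> i <= j -> weak s (seg xi i j) t ->
  @weak _ probe (At s i f) [::] (At t j f).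
Proof.
move=> ff; have lift k u v : weak u [::] v -> @weak _ probe (At u k f) [::] (At v k f).
  by apply: (@weak_lift _ L probe (fun u => At u k f)) => {}u {}v uv; left.
have [d] := ubnP (j - i); elim: d s i => // d IH s i dj.
rewrite leq_eqVlt => /predU1P[->|ij]; first by rewrite segii; apply: lift.
rewrite seg_cons // => st; have [u [v [su uv vt]]] := weak_consE st.
rewrite -[[::]]/([::] ++ [::]); apply: weak_cat (lift _ _ _ su) _.
apply: (@weak_taul _ probe _ _ (At v i.+1 f)); first by right.
by apply: IH vt => //; lia.
Qed.

Lemma probe_init_weak s i : mv f0 f0 -> weak (init L) (mkseq xi i) s ->
  @weak _ probe Start [::] (At s i f0).
Proof.
move=> mf0 si; apply: (@weak_taul _ probe _ _ (At (init L) 0 f0)) => //.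
by apply: probe_weak => //; rewrite seg0.
Qed.

Variables (h : Act -> Act) (e : Act).
Hypothesis h_inj : injective h.
Hypothesis hNc : forall a, h a <> c.

Hypothesis cNe : c <> e.

Definition graph : set (Act * Act) := [set p | p.2 = h p.1].

Lemma ren_graph a y : ren graph a y <-> y = h a.
Proof.
split=> [[//|[_ []]]|->]; last by left.
by exists (h a).
Qed.

Inductive tester_state := TStart | TStop | TAt of nat & F.

(** [e] starts [L] jointly with the run, so [L] has not begun in the branch to [TStop] and cannot
    disturb its stability. With [S] the alphabet of [L], the tester cannot perform a letter alone;
    its own full alphabet puts all visible actions of [L] under its control. *)
Definition tester_trans (S : set Act) q l q' : Prop :=
  match q, l, q' with
  | TStart, Some a, TStop => a = c
  | TStart, Some a, TAt i f => [/\ a = e, i = 0 & f = f0]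
  | TAt i f, Some a, TAt i' f' =>
      [/\ a = c, i' = i & jc i f f'] \/
      [/\ a = h (xi i), S (xi i), i' = i.+1 & mv f f']
  | _, _, _ => False
  end.

Lemma tester_trans_alph S q a q' : tester_trans S q (Some a) q' -> [set: Act] a.
Proof. by []. Qed.

Definition tester S : lts Act := LTS TStart (@tester_trans_alph S).

Definition probe_context S :=
  Defs.hide (par (Defs.prefix e (rename L graph)) (tester S)) (~` [set c]).

Definition probe_in (z : st probe) : st (probe_context (alph L)) :=
  match z with
  | Start => (None, TStart)
  | Stop => (None, TStop)
  | At s i f => (Some s, TAt i f)
  end.

Definition probe_out (z : st (probe_context (alph L))) : st probe :=
  match z with
  | (Some s, TAt i f) => At s i f
  | (_, TStop) => Stop
  | _ => Start
  end.

Lemma probe_contextP : CFFD_eq probe (probe_context (alph L)).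
Proof.
apply: (@iso_CFFD _ _ _ probe_in probe_out) => //; first by case.
  apply/predeqP => a; split=> [->|[_ /= /contrapT//]].
  by split=> /=; [right|case].
have inL a : alph L a -> in_alph (Defs.prefix e (rename L graph)) (Some (h a)).
  by move=> La; left; exists a => //; apply/ren_graph.
move=> z l [o q]; split; last first.
  case=> y -> {o q}; case: z l y => [||s i f] [a|] [||s' i' f'] //=.
  - move=> ->; split; last by case.
    apply: Or33; split=> //= -[[a' _ /ren_graph /esym/hNc //]|//].
  - case=> -> -> ->; right; exists e; first by move/esym.
    by apply: Or31; split=> //; right.
  - case=> -> -> -> jf; split; last by case.
    apply: Or33; split=> //=; last by left.
    by case=> [[a' _ /ren_graph /esym/hNc //]|//].
  - case=> [[ss' -> ->]|[ss' -> mf]]; first by left; apply: Or32; split.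
    right; exists (h (xi i)); first exact: hNc.
    apply: Or31; split=> //=.
    + exact/inL/trans_alph/ss'.
    + by exists (xi i) => //; apply/ren_graph.
    + by right; split=> //; apply: trans_alph ss'.
have inT a : in_alph (tester (alph L)) (Some a) by [].
have noT q1 : ~ trans (l := tester (alph L)) q1 None q.
  by case: q1 => [||? ?] [].
have inc a : in_alph (Defs.prefix e (rename L graph)) (Some a) -> a <> c.
  case=> [[a' _ /ren_graph -> /hNc//]|-> /esym //].
case: l => [a|].
  case=> + /contrapT /= ac; subst a; case=> [[/inc //]|[/(_ I) //]|[_ qt oE]].
  case: z qt oE => [||s i f] /=.
  - case: q {noT} => [||i' f'] //; last by case=> /cNe.
    by move=> _ ->; exists Stop.
  - by case: q {noT}.
  - case: q {noT} => [||i' f'] // [[_ -> jf] ->|[/esym /hNc]//].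
    by exists (At s i f').
case=> [[[[]]|[_ pt qE]|[_ /noT //]]|[a ac [[ia _ pt qt]|[/(_ I) //]|[na qt _]]]].
- case: z o pt qE => [||s i f] [s'|] //= => [[]//|[]//|ss' ->].
  by exists (At s' i f) => //; left.
- move: z o q {noT} pt qt => [||s i f] [s'|] [||i' f'] //=.
  + by move=> [_ ->] [_ -> ->]; exists (At (init L) 0 f0).
  + case=> a' ss' /ren_graph aE [[] //|[]].
    rewrite aE => /h_inj a'E _ -> mf; exists (At s' i.+1 f') => //.
    by right; rewrite -a'E.
- case: na; case: z q {noT} qt => [||s i f] [||i' f'] //=.
  + by case=> -> _ _; right.
  + by case=> [[]//|[-> La _ _]]; apply: inL.
Qed.

(** The letters of [xi] are silent in [probe], so following [xi] forever is a divergence. *)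
Lemma probe_Div_coind (P : st L -> nat -> Prop) f w s i :
  mv f f -> @weak _ probe Start w (At s i f) -> P s i ->
  (forall s i, P s i -> exists2 t, weak s [:: xi i] t & P t i.+1) ->
  Div probe w.
Proof.
move=> ff wz Ps Pstep; exists (At s i f) => //.
pose Q (z : st probe) := exists s i, z = At s i f /\ P s i.
apply: (diverges_coind (P := Q)); last by exists s, i.
move=> {Ps wz}_ [{}s [{}i [-> /Pstep[t st Pt]]]].
have [u [v [su uv vt]]] := weak_consE st.
have lift k u' v' : weak u' [::] v' -> @weak _ probe (At u' k f) [::] (At v' k f).
  by move=> H; apply: probe_weak; rewrite ?segii.
exists (At u i f), (At v i.+1 f), (At t i.+1 f); split; [exact: lift| |exact: lift|].
  by right.
by exists t, i.+1.
Qed.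

End Probe.

(** * Invariants forced by preservation of [nF] *)

Section ProbeCongruence.
Variables (Act : Type) (R : lts Act -> lts Act -> Prop).
Hypothesis R_cong : congruence R.
Hypothesis R_CFFD : forall L1 L2, CFFD_eq L1 L2 -> R L1 L2.
Variables (h : Act -> Act) (c e : Act).
Hypothesis h_inj : injective h.
Hypothesis hNc : forall a, h a <> c.

Hypothesis cNe : c <> e.

Lemma probe_cong xi F (f0 : F) mv jc L1 L2 : alph L1 = alph L2 -> R L1 L2 ->
  R (probe L1 xi f0 mv jc c) (probe L2 xi f0 mv jc c).
Proof.
move=> alE RL; have [_ Rsym Rtrans] := cong_equiv R_cong.
have P1 := R_CFFD (probe_contextP L1 xi f0 mv jc h_inj hNc cNe).
have P2 := R_CFFD (probe_contextP L2 xi f0 mv jc h_inj hNc cNe).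
apply: (Rtrans _ _ _ P1); apply: (Rtrans _ _ _ _ (Rsym _ _ P2)).
rewrite -alE; apply: (cong_hide R_cong); apply: (cong_parl R_cong).
by apply: (cong_prefix R_cong); apply: (cong_rename R_cong).
Qed.

Hypothesis R_nF : preserves R (@nF Act).

(** Refusal sets lie in the alphabet. Behind a prefix [x] other than [a], the initial state is
    stable, nondivergent and unable to perform [a], so the refusal of [a] tests membership in the
    alphabet. *)
Lemma nF_preserves_alph : preserves R (@alph Act).
Proof.
have sub L1 L2 a : R L1 L2 -> alph L1 a -> alph L2 a.
  move=> RL La; have [x xa] : exists x, x <> a.
    have [ca|ca] := pselect (c = a); last by exists c.
    by exists e; rewrite -ca => /esym.
  have nFx L : nF (Defs.prefix x L) ([::], [set a]) <-> alph L a.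
    split=> [[[/= H _] _]|Laa]; first by have [//|/= /esym] := H a erefl.
    split; last exact: prefix_nil_Div.
    split=> [_ -> |]; first by left.
    exists None; split; [exact: weak_refl|exact: prefix_stable|].
    by move=> _ -> [z|] //= [[/esym]].
  by apply/nFx; rewrite -(R_nF (cong_prefix R_cong x RL)); apply/nFx.
move=> L1 L2 RL; have [_ Rsym _] := cong_equiv R_cong.
by apply/predeqP => a; split; apply: sub => //; apply: Rsym.
Qed.

(** The flag records that [c] has been shown, which happens at position [n]; afterwards the run
    proceeds along [xi] only with [cont]. *)
Let mv cont (f f' : bool) := f' = f /\ (f -> cont).
Let jc n (i : nat) (f f' : bool) := [/\ i = n, f = false & f' = true].

Let test L xi n (cont : bool) := probe L xi false (mv cont) (jc n) c.

Let test_inv L xi n cont w (z : st (test L xi n cont)) :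
  weak (init (test L xi n cont)) w z ->
  match z with Start => w = [::] | Stop => True
  | At s i f => if f then n <= i /\ (~~ cont -> i = n) else w = [::] end.
Proof.
pose I (w : seq Act) (z : st (test L xi n cont)) :=
  match z with Start => w = [::] | Stop => True
  | At s i f => if f then n <= i /\ (~~ cont -> i = n) else w = [::] end.
suff: weak (init (test L xi n cont)) w z -> I ([::] ++ w) z by [].
apply: weak_invariant => // {w z} [w z z'|w z a z'];
  case: z z' => [||s i f] [||s' i' f'] //=.
- by move=> -> [_ _ ->].
- move=> H [[_ -> ->] //|[_ -> [-> fc]]].
  by case: f fc H => // /(_ isT) -> [ni _]; split=> //; apply: leqW.
- by move=> _ [_ _ -> [-> _ ->]].
Qed.

Lemma test_Div L xi n cont : Div (test L xi n cont) [:: c] <->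
  Div L (mkseq xi n) \/
  cont /\ ((exists2 i, n <= i & Div L (mkseq xi i)) \/ Inf L xi).
Proof.
have ready s : weak (init L) (mkseq xi n) s ->
    weak (init (test L xi n cont)) [:: c] (At s n true).
  move=> sn; rewrite -[[:: c]]/([::] ++ [:: c]).
  apply: (@weak_cat _ (test L xi n cont) _ _ _ (At s n false)); last exact: weak_act.
  exact: probe_init_weak.
have div s i : weak (init (test L xi n cont)) [:: c] (At s i true) -> diverges s ->
    Div (test L xi n cont) [:: c].
  move=> wz [p [p0 pt]]; exists (At s i true) => //.
  by exists (fun k => At (p k) i true); split=> [|k]; [rewrite p0|left].
split=> [[z wz /divergesP zd]|]; last first.
  case=> [[s ws sd]|[contT [[i ni [s ws sd]]|/weak_infP[p [p0 pw]]]]].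
  - exact: div (ready _ ws) sd.
  - move: ws; rewrite -(mkseq_seg xi ni) => /weak_split[t nt ts].
    apply: div sd; rewrite -[[:: c]]cats0; apply: weak_cat (ready _ nt) _.
    exact: probe_weak ts.
  - pose P s i := s = p i.
    apply: (probe_Div_coind (P := P) (s := p n) (i := n) (f := true)) => //.
      apply: ready; rewrite -p0; elim: (n) => [|k IH]; first exact: weak_refl.
      by rewrite mkseqS -cats1; apply: weak_cat IH (pw k).
    by move=> s i ->; exists (p i.+1).
apply: contrapT => /not_orP[nDn nc]; apply: zd.
have At_Acc s i : Acc (@tau_below _ L) s ->
    (forall u v, weak s [::] u -> trans u (Some (xi i)) v -> cont ->
      Acc (@tau_below _ (test L xi n cont)) (At v i.+1 true)) ->
    Acc (@tau_below _ (test L xi n cont)) (At s i true).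
  elim=> {}s _ IH H; constructor=> -[[]|[]|s' i' f' [[ss' -> ->]|[ss' -> [-> cT]]]].
    by apply: (IH _ ss') => u v s'u; apply: H; apply: weak_taul ss' s'u.
  by apply: (H s) => //; [exact: weak_refl|exact: cT].
have := test_inv wz; have := probe_reach wz.
case: z {wz} => [_ //|_ _|s i [] si]; last by [].
  by apply: stable_Acc => -[||? ? ?] [].
case=> ni iE.
have {}nc : cont -> (forall i, n <= i -> ~ Div L (mkseq xi i)) /\ ~ Inf L xi.
  move=> cT; split=> [j nj Dj|I]; apply: nc; split=> //; [by left; exists j|by right].
have [cT|/negP cF] := pselect cont; first have [nDi nI] := nc cT.
  move: ni; pose Q s i := n <= i -> Acc (@tau_below _ (test L xi n cont)) (At s i true).
  apply: (winf_ind (Q := Q) _ nI si) => {iE}{}s {}i {}si IH ni.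
  apply: At_Acc (Div_diverges si (nDi _ ni)) _ => u v su uv _.
  apply: (IH _ _ (ltnSn i)); last exact: leqW.
  by rewrite segS; apply: weak_cat su (weak_act uv).
rewrite (iE cF) in si *; apply: At_Acc (Div_diverges si nDn) _ => u v su uv cT.
by rewrite cT in cF.
Qed.

Lemma test_nF L xi n cont :
  nF (test L xi n cont) ([:: c], set0) <-> ~ Div (test L xi n cont) [:: c].
Proof.
split=> [[]//|nD]; split=> //; split=> [? []|]; exists (@Stop _ L bool).
split=> [|[||? ? ?] []|a []].
exact: (@weak_act _ (test L xi n cont)).
Qed.

Lemma nF_preserves_test L1 L2 xi n cont : R L1 L2 ->
  (Div (test L1 xi n cont) [:: c] <-> Div (test L2 xi n cont) [:: c]).
Proof.
move=> RL; have := test_nF L2 xi n cont; have := test_nF L1 xi n cont.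
rewrite (R_nF (probe_cong xi false (mv cont) (jc n) (nF_preserves_alph RL) RL)).
by move=> -> /not_iff_compat; rewrite !notK; tauto.
Qed.

Lemma nF_preserves_Div : preserves R (@Div Act).
Proof.
(* The default [c] extends [w] to an infinite word; without [cont] the test stops at the end of
   [w]. *)
move=> L1 L2 RL; apply/predeqP => w; rewrite -(mkseq_nth c w).
have := nF_preserves_test (nth c w) (size w) false RL; rewrite !test_Div.
move=> [H1 H2].
by split=> D; [case: (H1 (or_introl D))|case: (H2 (or_introl D))] => // -[].
Qed.

(** Started where no divergent prefix follows, the test with [cont] can diverge only by following
    [xi] forever. *)
Lemma nF_preserves_eanI : preserves R (@eanI Act).
Proof.
have sub L1 L2 xi : R L1 L2 -> eanI L1 xi -> eanI L2 xi.
  move=> RL [xi1 [n nD]]; have DE := nF_preserves_Div RL.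
  split; last by exists n => i; rewrite -DE; apply: nD.
  have := nF_preserves_test xi n true RL; rewrite !test_Div -DE => -[H _].
  case: H => [|D|[_ [[i ni D]|//]]].
  - by right; split=> //; right.
  - by case: (nD n).
  - by case: (nD i).
move=> L1 L2 RL; have [_ Rsym _] := cong_equiv R_cong.
by apply/predeqP => a; split; apply: sub => //; apply: Rsym.
Qed.

End ProbeCongruence.

(** * Measuring an infinite trace by a single action *)

Inductive phase := Going | Halted | Resumed.

Section Meter.
Variables (Act : Type) (c : Act) (L : lts Act) (xi : nat -> Act) (N : nat -> Prop).
Local Notation cs := (fun _ : nat => c).

(* A [Halted] phase is entered by an even number of [c]'s (the one of the prefix
   operator included), at positions in [N] only; as [Halted] needs a [c] to go on
   and [Resumed] needs a letter of [xi], infinitely many [c]'s traverse [xi]. *)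
Definition meter_mv (f f' : phase) := f <> Halted /\ f' = Going.

Definition meter_jc i (f f' : phase) :=
  [/\ N i, f = Going & f' = Halted] \/ f = Halted /\ f' = Resumed.

Definition meter := probe L xi Going meter_mv meter_jc c.

(** An even number of [c]'s in all is odd within the meter, which is then in [Stop] or [Halted].
    [Stop] is stable, and [Halted] leaves only tau steps of [L], at a nondivergent prefix. *)
Lemma meter_even_Div : (forall i, N i -> ~ Div L (mkseq xi i)) ->
  forall k, ~ Div (Defs.prefix c meter) (mkseq cs k.*2).
Proof.
move=> ND [|k]; rewrite ?doubleS; first exact: prefix_nil_Div.
have -> : mkseq cs k.*2.+2 = c :: mkseq cs k.*2.+1.
  by rewrite -seg0 seg_cons // -(add1n k.*2.+1) seg_const.
move/prefix_Div=> [z wz /divergesP zd]; apply: zd.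
pose I (w : seq Act) (z : st meter) :=
  match z with Start => w = [::] | Stop => True
  | At s i f => (odd (size w) -> f = Halted) /\ (f = Halted -> odd (size w) /\ N i) end.
have : I ([::] ++ mkseq cs k.*2.+1) z.
  apply: weak_invariant wz => // {z} [w z z'|w z a z'];
    case: z z' => [||s i f] [||s' i' f'] //=.
  - by move=> -> [_ _ ->].
  - move=> [H1 H2] [[_ -> ->] //|[_ -> [fH ->]]]; split=> // /H1 //.
  - rewrite size_rcons /= => -[H1 H2] [_ _ -> [[Ni fE ->]|[fE ->]]].
      by split=> // _; split=> //; apply/negP => /H1; rewrite fE.
    by split=> //; rewrite (H2 fE).1.
have := probe_reach wz; case: z {wz} => [_|_ _|s i f si] /=.
- by rewrite /mkseq.
- by constructor=> -[||? ? ?] [].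
rewrite size_map size_iota odd_double => -[/(_ isT) fE /(_ fE)[_ Ni]]; subst f.
elim: (Div_diverges si (ND _ Ni)) => {si}s _ IH.
by constructor=> -[[]|[]|s' i' f' [[ss' -> ->]|[_ _ []//]]]; apply: IH.
Qed.

Lemma meter_Inf : (forall n, exists2 i, n <= i & N i) -> Inf L xi -> Inf meter cs.
Proof.
move=> Nio /weak_infP[p [p0 pw]].
have pseg i j : i <= j -> weak (p i) (seg xi i j) (p j).
  elim: j => [|j IH]; first by rewrite leqn0 => /eqP->; rewrite segii; apply: weak_refl.
  rewrite leq_eqVlt => /predU1P[->|]; first by rewrite segii; apply: weak_refl.
  rewrite ltnS => ij; rewrite -(@seg_cat _ _ i j) ?ij ?leqnSn // segS.
  exact: weak_cat (IH ij) (pw j).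
pose P (z : st meter) (n : nat) := exists i f, z = At (p i) i f.
have going i : exists2 t, weak (L := meter) (At (p i) i Going) [:: c] t & P t 0.
  have [j ij Nj] := Nio i; exists (At (p j) j Halted); last by exists j, Halted.
  rewrite -[[:: c]]/([::] ++ [:: c]).
  apply: (@weak_cat _ meter _ _ _ (At (p j) j Going)).
    by apply: probe_weak => //; apply: pseg.
  by apply: (@weak_act _ meter); split=> //; left.
apply: (@Inf_coind _ meter cs P (At (p 0) 0 Going) 0).
- by rewrite p0; apply: (@weak_tau _ meter).
- by exists 0, Going.
move=> _ n [i [f ->]]; case: f.
- exact: going.
- exists (At (p i) i Resumed); last by exists i, Resumed.
  by apply: (@weak_act _ meter); split=> //; right.
have [t it Pt] := going i.+1; exists t => //.
have [u [v [su uv vt]]] := weak_consE (pw i).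
have lift k f u' v' : weak u' [::] v' -> @weak _ meter (At u' k f) [::] (At v' k f).
  by apply: (@weak_lift _ L meter (fun u => At u k f)) => u1 v1 u1v1; left.
rewrite -[[:: c]]/([::] ++ [:: c]); apply: weak_cat (lift i Resumed _ _ su) _.
apply: (@weak_taul _ meter _ _ (At v i.+1 Going)); first by right.
by rewrite -[[:: c]]/([::] ++ [:: c]); apply: weak_cat (lift _ _ _ _ vt) it.
Qed.

(** A bound on the [c]'s that can still be shown without advancing along [xi]. *)
Let rank f := match f with Going => 2 | Halted => 1 | Resumed => 0 end.

Let meter_progress s i f w (z : st meter) : @weak _ meter (At s i f) w z ->
  exists t j f', [/\ z = At t j f', i <= j, weak s (seg xi i j) t &
    j = i -> rank f = size w + rank f'].
Proof.
pose I (w : seq Act) (z : st meter) := exists t j f', [/\ z = At t j f', i <= j,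
  weak s (seg xi i j) t & j = i -> rank f = size w + rank f'].
suff: @weak _ meter (At s i f) w z -> I ([::] ++ w) z by [].
apply: weak_invariant => {w z} [w z z'|w z a z'|].
- case=> [t [j [f' [-> ij st rk]]]]; case: z' => //= t' j' f''.
  case=> [[tt' -> ->]|[tt' -> _]].
    by exists t', j, f'; split=> //; apply: weak_taur tt'.
  exists t', j.+1, f''; split=> //; first exact: leqW.
    rewrite -(@seg_cat _ _ i j) ?ij ?leqnSn // segS.
    by apply: weak_cat st (weak_act tt').
  by move=> jE; move: ij; rewrite -jE ltnn.
- case=> [t [j [f' [-> ij st rk]]]]; case: z' => //= t' j' f''.
  case=> _ -> -> jf; exists t, j, f''; split=> // /rk ->; rewrite size_rcons.
  by case: jf => [[_ -> ->]|[-> ->]] /=; lia.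
- exists s, i, f; split=> //; rewrite segii; exact: weak_refl.
Qed.

(** Each [c] comes with progress along [xi] or a drop of [rank], so a lexicographic induction
    applies if [xi] is not an infinite trace. *)
Lemma meter_Inf_sub : Inf meter cs -> Inf L xi.
Proof.
move=> /InfP nA; apply: contrapT => nI; apply: nA.
have AtA s i : weak (init L) (mkseq xi i) s ->
    forall f n, Acc (wstep cs) ((At s i f : st meter), n).
  pose Q s i := forall f n, Acc (wstep cs) ((At s i f : st meter), n).
  move=> si; apply: (winf_ind (Q := Q) _ nI si) => {s i si} s i si IH f n.
  suff: forall s', weak s [::] s' -> Acc (wstep cs) ((At s' i f : st meter), n).
    by apply; apply: weak_refl.
  have [r] := ubnP (rank f); elim: r f n => [//|r IHr] f n fr s' ss'.
  constructor=> -[z' n'] [/= -> /meter_progress [t [j [f' [-> ij st rk]]]]].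
  have [jE|jNi] := eqVneq j i.
    subst j; rewrite segii in st; apply: IHr; last exact: weak_cat ss' st.
    by have := rk erefl; rewrite /= => rkf; lia.
  apply: (IH t j); first by rewrite ltn_neqAle eq_sym jNi.
  exact: weak_cat ss' st.
constructor=> -[z' n'] [/= -> zz']; have := probe_reach zz'.
case: z' zz' => [//|zz' _|s i f _ si]; last exact: AtA.
constructor=> -[z n''] [_ /= Sz]; exfalso.
pose I (w : seq Act) (z : st meter) := w = [::] /\ z = @Stop _ L phase.
suff: I ([::] ++ [:: c]) z by case.
apply: weak_invariant Sz => // {z n''} [w u v|w u a v] [-> ->].
  by case: v.
by case: v.
Qed.

End Meter.

(** * From one separating trace to a coarser equivalence *)

Section Separation.
Variables (Act : Type) (R : lts Act -> lts Act -> Prop).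
Hypothesis R_cong : congruence R.
Hypothesis R_CFFD : forall L1 L2, CFFD_eq L1 L2 -> R L1 L2.
Hypothesis R_VB : R (V Act) (B Act).
Variables (h : Act -> Act) (c e : Act).
Hypothesis h_inj : injective h.
Hypothesis hNc : forall a, h a <> c.
Hypothesis cNe : c <> e.
Hypothesis R_nF : preserves R (@nF Act).
Local Notation cs := (fun _ : nat => c).

(** Saturation with [X2] keeps [nF], [Div] and [Inf], while [X1] adds exactly the recurrent words to
    [Inf]. Both results are congruent to each other, so [L] is congruent to the second one. *)
Lemma saturate_Inf (b : bool) X1 X2 : R X1 X2 ->
  alph X1 = [set c] -> alph X2 = [set c] ->
  (forall x, ~ trans (init X1) None x) -> (forall x, ~ trans (init X2) None x) ->
  (b -> forall k, ~ Div X1 (mkseq cs k.*2)) ->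
  (b -> forall k, ~ Div X2 (mkseq cs k.*2)) ->
  Inf X1 cs -> ~ Inf X2 cs ->
  forall L1 L2, alph L1 = alph L2 -> nF L1 = nF L2 -> Div L1 = Div L2 ->
    (forall xi, Inf L1 xi \/ recurrent L1 b xi <-> Inf L2 xi \/ recurrent L2 b xi) ->
  R L1 L2.
Proof.
move=> RX al1 al2 st1 st2 ev1 ev2 I1 I2 L1 L2 alE nE dE iE.
have [_ Rsym Rtrans] := cong_equiv R_cong.
have thmA := CFFD_modulo_VB h_inj hNc R_cong R_CFFD R_VB.
have Inf1 L xi : Inf (sat L b c X1) xi <-> Inf L xi \/ recurrent L b xi.
  split=> [H|[]]; [|exact: sat_Inf_sup|exact: sat_Inf_recurrent].
  have [|nI] := pselect (Inf L xi); first by left.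
  by right; apply: sat_Inf_sub_recurrent H nI.
have sat1 L : R L (sat L b c X1).
  apply: (Rtrans _ (sat L b c X2)).
    apply: thmA; split=> //; [by rewrite sat_nF|by rewrite sat_Div|].
    apply/predeqP => xi; split; first exact: sat_Inf_sup.
    by move=> H; apply: contrapT => nI; apply: I2; apply: sat_Inf_sub_X H nI.
  by apply: (sat_cong h_inj hNc) => //; apply: Rsym.
apply: (Rtrans _ _ _ (sat1 L1)); apply: (Rtrans _ _ _ _ (Rsym _ _ (sat1 L2))).
apply: thmA; split=> //; [by rewrite !sat_nF|by rewrite !sat_Div|].
by apply/predeqP => xi; rewrite !Inf1.
Qed.

(** The meters of [M1] and [M2], behind a [c] that makes them initially stable, serve as [X1] and
    [X2]; the parity condition passes to [M2] because [Div] is preserved. *)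
Lemma distinguished_Inf (b : bool) M1 M2 xi (N : nat -> Prop) : R M1 M2 ->
  Inf M1 xi -> ~ Inf M2 xi ->
  (forall n, exists2 i, n <= i & N i) ->
  (b -> forall i, N i -> ~ Div M1 (mkseq xi i)) ->
  forall L1 L2, alph L1 = alph L2 -> nF L1 = nF L2 -> Div L1 = Div L2 ->
    (forall xi, Inf L1 xi \/ recurrent L1 b xi <-> Inf L2 xi \/ recurrent L2 b xi) ->
  R L1 L2.
Proof.
move=> RM I1 I2 Nio ND.
have alM := nF_preserves_alph R_cong cNe R_nF RM.
have DE := nF_preserves_Div R_cong R_CFFD h_inj hNc cNe R_nF RM.
pose X M := Defs.prefix c (meter c M xi N).
apply: (@saturate_Inf b (X M1) (X M2)).
- apply: (cong_prefix R_cong).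
  exact: (probe_cong R_cong R_CFFD h_inj hNc cNe xi Going meter_mv (meter_jc N)).
- by rewrite /= setUid.
- by rewrite /= setUid.
- exact: prefix_stable.
- exact: prefix_stable.
- by move=> bT; apply: meter_even_Div; apply: ND.
- by move=> bT; apply: meter_even_Div; rewrite -DE; apply: ND.
- by apply/prefix_Inf; apply: meter_Inf.
- by move=> I; apply: I2; apply: (@meter_Inf_sub _ c M2 xi N); apply/(prefix_Inf c).
Qed.

End Separation.

(** * Witnesses, fresh actions and the classification *)

Lemma not_preserves_witness (Act : Type) (R : lts Act -> lts Act -> Prop)
    (X : lts Act -> set (nat -> Act)) : Symmetric R -> ~ preserves R X ->
  exists M1 M2 xi, [/\ R M1 M2, X M1 xi & ~ X M2 xi].
Proof.
move=> Rsym nX; apply: contrapT => H; apply: nX => M1 M2 RM.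
apply/predeqP => xi; split=> Xxi; apply: contrapT => nXxi; apply: H.
  by exists M1, M2, xi.
by exists M2, M1, xi; split=> //; apply: Rsym.
Qed.

(** [h] shifts an injective sequence [u] by one and fixes everything else, so its image avoids
    [u 0]. *)
Lemma infinite_shift (T : Type) : infinite_set [set: T] ->
  exists (h : T -> T) (c e : T), [/\ injective h, forall a, h a <> c & c <> e].
Proof.
move/infiniteP/card_leP => [f].
pose u n := val (f (SigSub (mem_set (I : [set: nat] n)))).
have u_inj : injective u.
  by move=> i j /val_inj/'inj_f; rewrite !in_setT => /(_ isT isT)[].
pose rel a y := (exists2 i, a = u i & y = u i.+1) \/ (~ (exists i, a = u i) /\ y = a).
have [h hP] : {h & forall a, rel a (h a)}.
  apply: choice => a; have [[i ->]|na] := pselect (exists i, a = u i).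
    by exists (u i.+1); left; exists i.
  by exists a; right.
exists h, (u 0), (u 1); split; last by move/u_inj.
- move=> a b; case: (hP a) (hP b) => [[i -> ->]|[na ->]] [[j -> ->]|[nb ->]] //.
  + by move/u_inj => [->].
  + by move=> uE; case: nb; exists i.+1.
  + by move=> uE; case: na; exists j.+1.
- move=> a; case: (hP a) => [[i _ ->] /u_inj //|[na ->] aE].
  by apply: na; exists 0.
Qed.

Theorem theorem7p12 (Act : Type) (R : lts Act -> lts Act -> Prop)
  (Act_infinite : infinite_set [set: Act])
  (R_cong : congruence R)
  (R_CFFD : forall L L' : lts Act, CFFD_eq L L' -> R L L')
  (R_VB : R (V Act) (B Act)) :
  (preserves R (@nF Act) -> ~ preserves R (@Sf Act) ->
   ~ preserves R (@aenI Act) ->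
   forall L L' : lts Act,
     R L L' <-> induced (@alph Act) (@nF Act) (@Div Act) (@eanI Act) L L')
  /\
  (preserves R (@nF Act) -> preserves R (@aenI Act) ->
   ~ preserves R (@Sf Act) -> ~ preserves R (@Inf Act) ->
   forall L L' : lts Act,
     R L L' <-> induced (@alph Act) (@nF Act) (@Div Act) (@aenI Act) L L')
  /\
  (preserves R (@nF Act) -> preserves R (@Inf Act) ->
   ~ preserves R (@Sf Act) ->
   forall L L' : lts Act,
     R L L' <-> induced (@alph Act) (@nF Act) (@Div Act) (@Inf Act) L L').
Proof.
have [h [c [e [h_inj hNc cNe]]]] := infinite_shift Act_infinite.
have [_ Rsym _] := cong_equiv R_cong.
have pres := fun nFp => (nF_preserves_alph R_cong cNe nFp,
  nF_preserves_Div R_cong R_CFFD h_inj hNc cNe nFp).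
have sep := distinguished_Inf R_cong R_CFFD R_VB h_inj hNc cNe.
split; last split.
- move=> nFp _ naenI; have [aP dP] := pres nFp.
  have [M1 [M2 [xi [RM [I1 nD1] nae2]]]] := not_preserves_witness Rsym naenI.
  have I2 : ~ Inf M2 xi by move=> I2; apply: nae2; split=> // n; rewrite -(dP _ _ RM).
  move=> L L'; split=> [RL|[aE nE dE eE]].
    split; [exact: aP|exact: nFp|exact: dP|].
    exact: (nF_preserves_eanI R_cong R_CFFD h_inj hNc cNe nFp RL).
  (* Halting is allowed at the nondivergent prefixes, of which [aenI] provides infinitely many. *)
  apply: (sep nFp true _ _ _ (fun i => ~ Div M1 (mkseq xi i)) RM I1 I2) => // zeta.
  (* An infinite trace has infinitely many divergent prefixes or belongs to [eanI]. *)
  have half K K' : Div K = Div K' -> eanI K = eanI K' ->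
      Inf K zeta \/ recurrent K true zeta -> Inf K' zeta \/ recurrent K' true zeta.
    rewrite /recurrent => dK eK [IK|]; last by rewrite dK; right.
    have [H|H] := pselect (forall n, exists2 i, n <= i & Div K (mkseq zeta i)).
      by right; rewrite -dK.
    left; have : eanI K zeta; last by rewrite eK => -[].
    split=> //; apply: contrapT => H'; apply: H => n; apply: contrapT => H''.
    by apply: H'; exists n => i ni Di; apply: H''; exists i.
  by split; apply: half.
- move=> nFp aenIp _ nInf; have [aP dP] := pres nFp.
  have [M1 [M2 [xi [RM I1 I2]]]] := not_preserves_witness Rsym nInf.
  move=> L L'; split=> [RL|[aE nE dE eE]].
    by split; [exact: aP|exact: nFp|exact: dP|exact: aenIp].
  apply: (sep nFp false _ _ _ (fun=> True) RM I1 I2) => // [n|zeta]; first by exists n.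
  (* Dually, almost all prefixes of an infinite trace are divergent or it belongs to [aenI]. *)
  have half K K' : Div K = Div K' -> aenI K = aenI K' ->
      Inf K zeta \/ recurrent K false zeta -> Inf K' zeta \/ recurrent K' false zeta.
    rewrite /recurrent => dK eK [IK|]; last by rewrite dK; right.
    have [H|H] := pselect (exists n, forall i, n <= i -> Div K (mkseq zeta i)).
      by right; rewrite -dK.
    left; have : aenI K zeta; last by rewrite eK => -[].
    split=> // n; apply: contrapT => H'; apply: H; exists n => i ni.
    by apply: contrapT => H''; apply: H'; exists i.
  by split; apply: half.
- move=> nFp Infp _ L L'; have [aP dP] := pres nFp; split=> [RL|].
    by split; [exact: aP|exact: nFp|exact: dP|exact: Infp].
  exact: (CFFD_modulo_VB h_inj hNc R_cong R_CFFD R_VB).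
Qed.
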